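(* Let $\mu_{\operatorname{O}}:\mathcal M_{1,2}(\mathcal V)\to\mathfrak o_{1,2}(\mathcal V)^*$ be the momentum map $\langle\mu_{\operatorname{O}}(M)|A\rangle=-\frac12\operatorname{Tr}\big((M^*JM-J)A\big)$ of the right action of $\operatorname{O}_{1,2}(\mathcal V)$ on $\mathcal M_{1,2}(\mathcal V)$ by right multiplication, $M\cdot a=Ma$. Then $\mu_{\operatorname{O}}$ is not equivariant. For all $M\in\mathcal M_{1,2}(\mathcal V)$, $a\in\operatorname{O}_{1,2}(\mathcal V)$ and $A\in\mathfrak o_{1,2}(\mathcal V)$ one has $$\langle\mu_{\operatorname{O}}(M\cdot a)-\operatorname{Ad}^*(a)(\mu_{\operatorname{O}}(M))\,|\,A\rangle=-\tfrac12\operatorname{Tr}\big((a^{-1}Ja-J)A\big).$$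
   Context: $\mathcal V$ is a real infinite-dimensional separable Hilbert space with inner product $\langle\cdot,\cdot\rangle_{\mathcal V}$, and $J$ is a bounded real-linear operator on $\mathcal V$ with $J^2=-\operatorname{id}_{\mathcal V}$ and $\langle Ju,Jv\rangle_{\mathcal V}=\langle u,v\rangle_{\mathcal V}$. $\mathcal H=\mathcal V\otimes\mathbb C$ is the complexification with its induced Hermitian scalar product, $J$ is extended $\mathbb C$-linearly to $\mathcal H$, and $\mathcal H=\mathcal H_+\oplus\mathcal H_-$ where $\mathcal H_\pm$ is the eigenspace of $J$ for $\pm i$. Complex conjugation of $\mathcal H$ with respect to $\mathcal V$ exchanges $\mathcal H_\pm$; for a bounded operator $A$ set $\bar Au:=\overline{A\bar u}$; $A^*$ is the Hermitian adjoint. $L^1$, $L^2$ denote trace class and Hilbert-Schmidt operators; $\operatorname{Tr}$ is the trace on $\mathcal H$. With block matrices relative to $\mathcal H_+\oplus\mathcal H_-$, $$\mathfrak{gl}_{1,2}(\mathcal V)=\left\{\begin{pmatrix}A_1&A_2\\ \bar A_2&\bar A_1\end{pmatrix}\ \middle|\ A_1\in L^1(\mathcal H_+),\ A_2\in L^2(\mathcal H_-,\mathcal H_+)\right\},$$ a real Banach space with norm $\|A_1\|_1+\|A_2\|_2$; $\mathcal M_{1,2}(\mathcal V):=\operatorname{id}_{\mathcal H}+\mathfrak{gl}_{1,2}(\mathcal V)$, and $\operatorname{GL}_{1,2}(\mathcal V)$ is the group of invertible elements of $\mathcal M_{1,2}(\mathcal V)$. $\mathcal M_{1,2}(\mathcal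 V)$ carries the constant (weak) symplectic form $\omega_{\mathcal M}(V_1,V_2)=\operatorname{Tr}V_1^*JV_2$. $$\operatorname{O}_{1,2}(\mathcal V)=\{a\in\operatorname{GL}_{1,2}(\mathcal V)\mid a^*a=\operatorname{id}_{\mathcal H}\},\qquad \mathfrak o_{1,2}(\mathcal V)=\{A\in\mathfrak{gl}_{1,2}(\mathcal V)\mid A^*+A=0\}$$ are a Banach Lie group and its Lie algebra; $\mathfrak o_{1,2}(\mathcal V)^*$ is the topological dual and $\langle\cdot|\cdot\rangle$ the duality pairing. The momentum map $\mu_G$ of a right action of $G$ is called equivariant when $\mu_G(M\cdot g)=\operatorname{Ad}^*(g)(\mu_G(M))$ for all $M$ and all $g\in G$, where $(\operatorname{Ad}^*(g)\xi)(A)=\xi(\operatorname{Ad}(g)A)=\xi(gAg^{-1})$ for $\xi\in\mathfrak g^*$, $A\in\mathfrak g$. *)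

(* Defs.v *)
From HB Require Import structures.
From mathcomp Require Import all_boot all_order all_algebra.
From mathcomp Require Import complex.
From mathcomp Require Import all_classical all_reals all_analysis.

Set Implicit Arguments.
Unset Strict Implicit.
Unset Printing Implicit Defensive.

Import Order.TTheory GRing.Theory Num.Theory.
Import numFieldNormedType.Exports.

Local Open Scope classical_set_scope.
Local Open Scope ring_scope.
Local Open Scope complex_scope.

(* V (x) C is V * V, the pair (a, b) standing for a + i b. *)
Definition complexification (R : realType) (V : lmodType R) : Type :=
  (V * V)%type.

Section Complexification.
Context (R : realType) (V : lmodType R).
Local Notation H := (complexification V).

HB.instance Definition _ :=
  GRing.Zmodule.copy (complexification V) (V * V)%type.

Definition cplx_scale (c : R[i]) (u : H) : H :=
  (complex.Re c *: u.1 - complex.Im c *: u.2,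
   complex.Re c *: u.2 + complex.Im c *: u.1).

Fact cplx_scaleA a b u :
  cplx_scale a (cplx_scale b u) = cplx_scale (a * b) u.
Proof.
case: a b u => a1 a2 [b1 b2] [x y]; rewrite /cplx_scale /=; congr pair => /=.
  rewrite scalerBr scalerDr !scalerA scalerBl scalerDl !opprD.
  by rewrite [X in _ + X = _]addrC addrACA.
rewrite scalerBr scalerDr !scalerA scalerBl scalerDl.
by rewrite [X in _ + X = _]addrC addrACA.
Qed.

Fact cplx_scale1 : left_id 1 cplx_scale.
Proof. by case=> x y; rewrite /cplx_scale /= !scale1r !scale0r subr0 addr0. Qed.

Fact cplx_scaleDr : right_distributive cplx_scale +%R.
Proof.
case=> a1 a2 [x y] [x' y']; rewrite /cplx_scale /=; congr pair => /=.
  by rewrite !scalerDr opprD addrACA.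
by rewrite !scalerDr addrACA.
Qed.

Fact cplx_scaleDl u : {morph cplx_scale^~ u : a b / a + b}.
Proof.
case: u => x y [a1 a2] [b1 b2]; rewrite /cplx_scale /=; congr pair => /=.
  by rewrite !scalerDl opprD addrACA.
by rewrite !scalerDl addrACA.
Qed.

HB.instance Definition _ := GRing.Zmodule_isLmodule.Build R[i] H
  cplx_scaleA cplx_scale1 cplx_scaleDr cplx_scaleDl.

End Complexification.

Section RestrictedGroups.
Context (R : realType) (V : normedModType R) (ip : V -> V -> R) (J : V -> V).
Local Notation H := (complexification V).

(* Linear in the first variable, antilinear in the second. *)
Definition hdot (u v : H) : R[i] :=
  (ip u.1 v.1 + ip u.2 v.2) +i* (ip u.2 v.1 - ip u.1 v.2).

Definition hnorm (u : H) : R := Num.sqrt (complex.Re (hdot u u)).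

Definition hconj (u : H) : H := (u.1, - u.2).

Definition barop (A : H -> H) : H -> H := fun u => hconj (A (hconj u)).

Definition JC : H -> H := fun u => (J u.1, J u.2).

Definition Hplus : set H := [set u | JC u = 'i%C *: u].
Definition Hminus : set H := [set u | JC u = (- 'i%C) *: u].

(* The orthogonal projection of H onto Hplus. *)
Definition proj_plus : H -> H := fun u => 2^-1 *: (u - 'i%C *: JC u).

(* Bounded operators between closed subspaces E and F of H are represented by
   functions H -> H whose values outside E are irrelevant. *)
Definition bounded_op (E F : set H) (T : H -> H) : Prop :=
  [/\ forall u, E u -> F (T u),
      forall (c : R[i]) u v, E u -> E v -> T (c *: u + v) = c *: T u + T v
    & exists C : R, forall u, E u -> hnorm (T u) <= C * hnorm u].

(* Infinite maximal orthonormal sequences of E. *)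
Definition hilbert_basis (E : set H) (e : nat -> H) : Prop :=
  [/\ forall n, E (e n),
      forall m n, hdot (e m) (e n) = (m == n)%:R
    & forall u, E u -> (forall n, hdot u (e n) = 0) -> u = 0].

(* An arbitrary basis; the norms, the trace and the classes L1 and L2 below do
   not depend on this choice. *)
Definition onb (E : set H) : nat -> H := xget (fun=> 0) (hilbert_basis E).

(* P = |T|, the positive square root of T^* T, for T defined on E. *)
Definition is_absop (E : set H) (T P : H -> H) : Prop :=
  [/\ bounded_op E E P,
      forall u, E u -> 0 <= hdot (P u) u
    & forall u v, E u -> E v -> hdot (P (P u)) v = hdot (T u) (T v)].

Definition absop (E : set H) (T : H -> H) : H -> H :=
  xget (fun=> 0) (is_absop E T).

Definition trace_norm (E : set H) (T : H -> H) : \bar R :=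
  (\sum_(0 <= n <oo)
     (complex.Re (hdot (absop E T (onb E n)) (onb E n)))%:E)%E.

Definition hs_sqnorm (E : set H) (T : H -> H) : \bar R :=
  (\sum_(0 <= n <oo) (hnorm (T (onb E n)) ^+ 2)%:E)%E.

Definition L1 (E F : set H) (T : H -> H) : Prop :=
  bounded_op E F T /\ (trace_norm E T < +oo)%E.

Definition L2 (E F : set H) (T : H -> H) : Prop :=
  bounded_op E F T /\ (hs_sqnorm E T < +oo)%E.

Definition Tr (T : H -> H) : R[i] :=
  limn (series (fun n => hdot (T (onb setT n)) (onb setT n) : R[i]^o)).

Definition adjoint (A : H -> H) : H -> H :=
  xget (fun=> 0) [set B : H -> H | bounded_op setT setT B /\
                                   forall u v, hdot (A u) v = hdot u (B v)].

Definition inverse_op (A : H -> H) : H -> H :=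
  xget (fun=> 0) [set B : H -> H | A \o B = idfun /\ B \o A = idfun].

Definition gl12 (A : H -> H) : Prop :=
  exists A1 A2 : H -> H,
    [/\ L1 Hplus Hplus A1, L2 Hminus Hplus A2
      & forall u v, Hplus u -> Hminus v ->
          A (u + v) = (A1 u + A2 v) + (barop A2 u + barop A1 v)].

(* For A in gl12, the blocks A1 and A2 are the restrictions of proj_plus \o A
   to Hplus and Hminus. *)
Definition gl12_norm (A : H -> H) : R :=
  fine (trace_norm Hplus (proj_plus \o A)) +
  Num.sqrt (fine (hs_sqnorm Hminus (proj_plus \o A))).

Definition M12 (M : H -> H) : Prop := gl12 (M - idfun).

Definition GL12 (a : H -> H) : Prop :=
  M12 a /\ exists b, [/\ M12 b, a \o b = idfun & b \o a = idfun].

Definition O12 (a : H -> H) : Prop := GL12 a /\ adjoint a \o a = idfun.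

Definition o12 (A : H -> H) : Prop := gl12 A /\ adjoint A + A = 0.

(* Functionals are C-valued functions on operators, of which only the values
   on o12 matter; elements of the dual are the real-valued, real-linear and
   bounded ones. *)
Definition o12_dual (xi : (H -> H) -> R[i]) : Prop :=
  [/\ forall A, o12 A -> xi A \is Num.real,
      forall (t : R) A B, o12 A -> o12 B ->
        xi (t%:C *: A + B) = t%:C * xi A + xi B
    & exists C : R, forall A, o12 A -> `|xi A| <= (C * gl12_norm A)%:C].

Definition coAd (g : H -> H) (xi : (H -> H) -> R[i]) : (H -> H) -> R[i] :=
  fun A => xi (g \o A \o inverse_op g).

Definition omegaM (V1 V2 : H -> H) : R[i] := Tr (adjoint V1 \o JC \o V2).

(* mu takes its values in the dual of o12, and for every A in o12 the function
   M |-> mu M A is Frechet differentiable on the affine space M12, with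
   differential W |-> omegaM (M A) W at M; here M |-> M A is the vector field
   generated by A for the action of O12 by right multiplication. *)
Definition momentum_map (mu : (H -> H) -> (H -> H) -> R[i]) : Prop :=
  (forall M, M12 M -> o12_dual (mu M)) /\
  forall M A, M12 M -> o12 A -> forall eps : R, 0 < eps ->
    exists2 delta : R, 0 < delta &
      forall W, gl12 W -> gl12_norm W < delta ->
        `|mu (M + W) A - mu M A - omegaM (M \o A) W| <= (eps * gl12_norm W)%:C.

Definition equivariant (mu : (H -> H) -> (H -> H) -> R[i]) : Prop :=
  forall M a, M12 M -> O12 a ->
    forall A, o12 A -> mu (M \o a) A = coAd a (mu M) A.

Definition muO (M A : H -> H) : R[i] :=
  - 2^-1 * Tr ((adjoint M \o JC \o M - JC) \o A).

End RestrictedGroups.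

(* Main.v *)
(** An operator [A] of gl12 is determined by its upper row [T = p+ A], namely
    [A = T + barop T]; the trace norm dominates the Hilbert-Schmidt norm, so [A]
    is Hilbert-Schmidt, with norm controlled by that of gl12.  For [M = 1 + X]
    the operator [M^* J M - J = X^* J + M^* J X] is then Hilbert-Schmidt as well,
    and every trace that occurs is the trace of a product of two Hilbert-Schmidt
    operators.  Such traces are basis independent and cyclic, by polarization of
    [\sum |T e_n|^2 = \sum |T^* f_n|^2], and they are real for operators that
    commute with conjugation.  The defect of equivariance follows from
    [(M a)^* J (M a) - J = a^-1 (M^* J M - J) a + (a^-1 J a - J)] and cyclicity.
    It does not vanish for the reflection [a = 1 - <., s> s], with [s = x + y],
    and [A = i <., x> x - i <., y> y], where [x] is a unit vector of H+ and [y]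
    its conjugate: then [a^-1 J a - J = - 2 A], and the trace is 4. *)

Require Import Defs.
From mathcomp Require Import all_boot all_order all_algebra.
From mathcomp Require Import ring lra.
From mathcomp Require Import complex.
From mathcomp Require Import all_classical all_reals all_analysis.
Import Order.TTheory GRing.Theory Num.Theory.
Import numFieldNormedType.Exports.
Local Open Scope classical_set_scope.
Local Open Scope ring_scope.
Local Open Scope complex_scope.

Set Implicit Arguments.
Unset Strict Implicit.
Unset Printing Implicit Defensive.

(** Bases, adjoints, inverses and [|T|] are all values of [xget], with a zero map as default, so
    each of them has to be shown to exist before a norm or a trace carries any information.
    Separability and infinite dimension give the bases, completeness gives adjoints through the
    Riesz theorem, and [|T|] requires a square root of [T^* T]. Afterwards only the specifications
    matter.

    A second obstacle is the choice of basis: [Tr] is a series along one basis of [H] that ignores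
    the splitting, while the norm of gl12 is computed along bases of the two halves. Passing to an
    adjoint is what changes the basis, because the sums of squares of an operator and of its adjoint
    are the same double series of squared matrix coefficients.

    The term [- J] in the momentum map is there to leave a Hilbert-Schmidt operator. Conjugation by
    [a] does not fix [J], which makes this term the source of the defect; a counterexample must
    therefore mix [H+] and [H-]. *)

Class norm_of_dot (R : realType) (V : normedModType R) (ip : {dot V for idfun}) :=
  sqr_norm_dot : forall v : V, `|v| ^+ 2 = ip v v.

(** * Complex numbers: squared modulus and discriminants *)

Section ComplexNumbers.
Context (R : realType).
Implicit Types z w : R[i].

(** Takes its values in [R], whereas the norm of [R[i]] takes its values in [R[i]]; the estimates
    below thus stay in an ordered field. *)
Definition sqmod z : R := complex.Re z ^+ 2 + complex.Im z ^+ 2.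

Lemma conjcD z w : conjc (z + w) = conjc z + conjc w.
Proof. exact: rmorphD. Qed.

Lemma conjcN z : conjc (- z) = - conjc z.
Proof. exact: rmorphN. Qed.

Lemma conjcM z w : conjc (z * w) = conjc z * conjc w.
Proof. exact: rmorphM. Qed.

Lemma conjc_sum (I : Type) (r : seq I) (P : pred I) (F : I -> R[i]) :
  conjc (\sum_(i <- r | P i) F i) = \sum_(i <- r | P i) conjc (F i).
Proof. exact: (big_morph (@conjc R) conjcD (conjc0 R)). Qed.

Lemma Re_conjc z : complex.Re (conjc z) = complex.Re z.
Proof. by case: z. Qed.

Lemma sqmod_ge0 z : 0 <= sqmod z.
Proof. by rewrite addr_ge0 ?sqr_ge0. Qed.

Lemma normc_sqmod z : `|z| = (Num.sqrt (sqmod z))%:C.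
Proof. by rewrite normc_def. Qed.

Lemma mulc_conj z : z * conjc z = (sqmod z)%:C.
Proof. by case: z => a b; rewrite /sqmod /=; simpc; congr (_ +i* _); ring. Qed.

Lemma sqmodM z w : sqmod (z * w) = sqmod z * sqmod w.
Proof. by case: z w => a b [c d]; rewrite /sqmod; simpc => /=; ring. Qed.

Lemma sqmod_conj z : sqmod (conjc z) = sqmod z.
Proof. by case: z => a b; rewrite /sqmod /= sqrrN. Qed.

Lemma real_complex_ge0 (x : R) : 0 <= x -> 0 <= x%:C.
Proof. by rewrite ler0c. Qed.

Lemma sqmod_real (x : R) : sqmod x%:C = x ^+ 2.
Proof. by rewrite /sqmod /= expr0n addr0. Qed.

Lemma complex_ext z w : complex.Re z = complex.Re w ->
  complex.Im z = complex.Im w -> z = w.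
Proof. by case: z w => a b [c d] /= -> ->. Qed.

(** Cauchy-Schwarz in abstract form: for a semidefinite form with [a = <v,v>], [b = <u,u>] and
    [z = <u,v>], the hypothesis is positivity at [v + c u]. It serves the scalar product, the form
    of a positive operator and finite sums of scalar products. *)
Lemma quadratic_form_discr (a b : R) z : 0 <= b ->
  (forall c : R[i], 0 <= a + 2 * complex.Re (c * z) + sqmod c * b) ->
  sqmod z <= a * b.
Proof.
move=> b0 H; have q0 := sqmod_ge0 z.
(* [c = - t conj z] makes the cross term real and leaves a real polynomial in [t]. *)
have K (t : R) : 0 <= a - 2 * t * sqmod z + t ^+ 2 * sqmod z * b.
  have := H (- t%:C * conjc z); rewrite -[_ * _ * z]mulrA [conjc z * z]mulrC mulc_conj sqmodM.
  rewrite sqmod_conj; have -> : sqmod (- t%:C) = t ^+ 2.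
    by rewrite /sqmod /= oppr0 sqrrN expr0n addr0.
  rewrite (_ : complex.Re _ = - t * sqmod z); last by simpc => /=; ring.
  by congr (_ <= _); ring.
(* For [b > 0] the minimum is at [t = 1/b]. For [b = 0] the polynomial is affine in [t] and, were
   [z] nonzero, would reach the value -1. *)
have [b1|b1] := ltrP 0 b.
  have := K b^-1; rewrite (_ : _ - _ + _ = a - sqmod z / b); last first.
    by field; rewrite gt_eqF.
  by rewrite subr_ge0 ler_pdivrMr.
have {b1}b1 : b = 0 by apply/eqP; rewrite eq_le b1.
rewrite b1 mulr0; rewrite leNgt; apply/negP => q1.
have a0 : 0 <= a by have := K 0; lra.
have := K ((a + 1) / (2 * sqmod z)); rewrite b1 mulr0 addr0.
rewrite (_ : _ - _ = -1); last by field; rewrite gt_eqF.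
by rewrite ler0N1.
Qed.

End ComplexNumbers.

(** * The Hermitian product of the complexification *)

Section HermitianProduct.
Context (R : realType) (V : completeNormedModType R) (ip : {dot V for idfun}).
Local Notation H := (complexification V).
Local Notation dot := (hdot ip).
Local Notation nrm := (hnorm ip).
Implicit Types (u v w : H) (c : R[i]).

Let ipC x y : ip x y = ip y x.
Proof. by have := hermC ip x y; rewrite expr0 mul1r. Qed.
Let ipDl x y z : ip (x + y) z = ip x z + ip y z.
Proof. exact: linearDl. Qed.
Let ipNl x z : ip (- x) z = - ip x z.
Proof. exact: linearNl. Qed.
Let ipZl (a : R) x z : ip (a *: x) z = a * ip x z.
Proof. exact: linearZl_LR. Qed.

Lemma hdotC u v : dot v u = conjc (dot u v).
Proof.
rewrite /hdot /=; congr (_ +i* _); first by rewrite ipC [ip v.2 _]ipC.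
by rewrite opprB ipC [ip v.1 _]ipC.
Qed.

Lemma hdotDl u v w : dot (u + v) w = dot u w + dot v w.
Proof.
by rewrite /hdot /=; simpc; rewrite !ipDl; congr (_ +i* _); ring.
Qed.

Lemma hdotZl c u w : dot (c *: u) w = c * dot u w.
Proof.
case: c => a b; rewrite /hdot /=; simpc.
by rewrite !(ipDl, ipNl, ipZl); congr (_ +i* _); ring.
Qed.

Lemma hdotNl u w : dot (- u) w = - dot u w.
Proof. by rewrite -scaleN1r hdotZl mulN1r. Qed.

Lemma hdotBl u v w : dot (u - v) w = dot u w - dot v w.
Proof. by rewrite hdotDl hdotNl. Qed.

Lemma hdot0l w : dot 0 w = 0.
Proof. by rewrite -(scale0r 0) hdotZl mul0r. Qed.

Lemma hdotDr u v w : dot w (u + v) = dot w u + dot w v.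
Proof. by rewrite hdotC hdotDl conjcD -!hdotC. Qed.

Lemma hdotZr c u w : dot w (c *: u) = conjc c * dot w u.
Proof. by rewrite hdotC hdotZl conjcM -hdotC. Qed.

Lemma hdotNr u w : dot w (- u) = - dot w u.
Proof. by rewrite hdotC hdotNl conjcN -hdotC. Qed.

Lemma hdotBr u v w : dot w (u - v) = dot w u - dot w v.
Proof. by rewrite hdotDr hdotNr. Qed.

Lemma hdot0r w : dot w 0 = 0.
Proof. by rewrite hdotC hdot0l conjc0. Qed.

Lemma hdot_suml (I : Type) (r : seq I) (P : pred I) (F : I -> H) w :
  dot (\sum_(i <- r | P i) F i) w = \sum_(i <- r | P i) dot (F i) w.
Proof.
by apply: (big_morph (fun x => dot x w)) => [x y|]; rewrite ?hdotDl ?hdot0l.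
Qed.

Lemma hdot_sumr (I : Type) (r : seq I) (P : pred I) (F : I -> H) w :
  dot w (\sum_(i <- r | P i) F i) = \sum_(i <- r | P i) dot w (F i).
Proof.
by apply: (big_morph (fun x => dot w x)) => [x y|]; rewrite ?hdotDr ?hdot0r.
Qed.

Lemma hdot_hconj u v : dot (hconj u) (hconj v) = conjc (dot u v).
Proof.
rewrite /hdot /hconj /= !ipNl ![ip _ (- _)]ipC !ipNl opprK.
by congr (_ +i* _); rewrite ?opprB ?[ip v.2 _]ipC ?[ip _ v.1]ipC//; ring.
Qed.

Context {ip_norm : norm_of_dot ip}.

Lemma hdotuu_Re_ge0 u : 0 <= complex.Re (dot u u).
Proof. by rewrite /hdot /= -!sqr_norm_dot addr_ge0// sqr_ge0. Qed.

Lemma hnormE u : nrm u ^+ 2 = complex.Re (dot u u).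
Proof. by rewrite sqr_sqrtr// hdotuu_Re_ge0. Qed.

Lemma hdotuu u : dot u u = (nrm u ^+ 2)%:C.
Proof. by rewrite hnormE /hdot /= (ipC u.2 u.1) subrr. Qed.

Lemma hnorm_pair u : nrm u ^+ 2 = `|u.1| ^+ 2 + `|u.2| ^+ 2.
Proof. by rewrite hnormE /hdot /= !sqr_norm_dot. Qed.

Lemma hnorm_ge0 u : 0 <= nrm u.
Proof. exact: sqrtr_ge0. Qed.

Lemma hnorm0 : nrm 0 = 0.
Proof. by rewrite /hnorm hdot0l sqrtr0. Qed.

Lemma hnorm0_eq0 u : nrm u = 0 -> u = 0.
Proof.
move=> u0; have := hnorm_pair u; rewrite u0 expr0n => /esym/eqP.
rewrite paddr_eq0 ?sqr_ge0// !sqrf_eq0 !normr_eq0 => /andP[/eqP u1 /eqP u2].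
by case: u u1 u2 {u0} => x y /= -> ->.
Qed.

Lemma hdot_separates u v : (forall w, dot w u = dot w v) -> u = v.
Proof.
move=> uv; apply/eqP; rewrite -subr_eq0; apply/eqP/hnorm0_eq0.
apply/eqP; rewrite -sqrf_eq0 hnormE hdotBr uv subrr.
by rewrite /= eqxx.
Qed.

Lemma hnormZ2 c u : nrm (c *: u) ^+ 2 = sqmod c * nrm u ^+ 2.
Proof.
apply: (@complexI R).
by rewrite -hdotuu hdotZl hdotZr mulrA mulc_conj hdotuu -rmorphM.
Qed.

Lemma hnormZ c u : nrm (c *: u) = Num.sqrt (sqmod c) * nrm u.
Proof.
apply/eqP; rewrite -(@eqrXn2 _ 2) ?hnorm_ge0 ?mulr_ge0 ?hnorm_ge0 ?sqrtr_ge0//.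
by rewrite hnormZ2 exprMn (sqr_sqrtr (sqmod_ge0 c)). 
Qed.

Lemma hnormN u : nrm (- u) = nrm u.
Proof. by rewrite /hnorm hdotNl hdotNr opprK. Qed.

Lemma hnormB u v : nrm (u - v) = nrm (v - u).
Proof. by rewrite -hnormN opprB. Qed.

Lemma hnormD2 u v :
  nrm (u + v) ^+ 2 = nrm u ^+ 2 + 2 * complex.Re (dot u v) + nrm v ^+ 2.
Proof.
rewrite !hnormE hdotDl !hdotDr (hdotC u v).
by case: (dot u u) (dot u v) (dot v v) => [a b] [c d] [e f] /=; ring.
Qed.

Lemma hdot_CS u v : sqmod (dot u v) <= nrm u ^+ 2 * nrm v ^+ 2.
Proof.
rewrite mulrC; apply: quadratic_form_discr => [|c]; first by rewrite sqr_ge0.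
have := sqr_ge0 (nrm (v + c *: u)); rewrite hnormD2 hnormZ2 hdotZr.
by rewrite (hdotC u v) -conjcM Re_conjc.
Qed.

End HermitianProduct.

(** * Convergence of complex sequences *)

Section Convergence.
Context (R : realType).

(** Tested on the two coordinates, so that real limits suffice; [ccvg_limn] returns to the limit in
    [R[i]] by which [Tr] is defined. *)
Definition ccvg (z : nat -> R[i]) (l : R[i]) : Prop :=
  (fun n => complex.Re (z n)) @ \oo --> complex.Re l /\
  (fun n => complex.Im (z n)) @ \oo --> complex.Im l.

Lemma ccvg_unique z l m : ccvg z l -> ccvg z m -> l = m.
Proof.
move=> [zl1 zl2] [zm1 zm2]; apply: complex_ext.
  exact: (cvg_unique (@norm_hausdorff _ R^o) zl1 zm1).
exact: (cvg_unique (@norm_hausdorff _ R^o) zl2 zm2).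
Qed.

Lemma ccvgD z w l m : ccvg z l -> ccvg w m -> ccvg (fun n => z n + w n) (l + m).
Proof.
move=> [zl1 zl2] [wm1 wm2].
have aux (x y : R[i]) : complex.Re (x + y) = complex.Re x + complex.Re y /\
   complex.Im (x + y) = complex.Im x + complex.Im y.
  by case: x y => a b [c d].
split.
  rewrite (aux l m).1; under eq_fun do rewrite (aux _ _).1.
  exact: (@cvgD _ R^o).
rewrite (aux l m).2; under eq_fun do rewrite (aux _ _).2.
exact: (@cvgD _ R^o).
Qed.

Lemma ccvgZ c z l : ccvg z l -> ccvg (fun n => c * z n) (c * l).
Proof.
move=> [zl1 zl2].
have aux (x : R[i]) :
   complex.Re (c * x) = complex.Re c * complex.Re x - complex.Im c * complex.Im x
   /\ complex.Im (c * x) = complex.Re c * complex.Im x + complex.Im c * complex.Re x.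
  by case: c x => a b [a' b'].
split.
  rewrite (aux l).1; under eq_fun do rewrite (aux _).1.
  by apply: (@cvgB _ R^o); apply: cvgM => //; apply: cvg_cst.
rewrite (aux l).2; under eq_fun do rewrite (aux _).2.
by apply: (@cvgD _ R^o); apply: cvgM => //; apply: cvg_cst.
Qed.

Lemma ccvgJ z l : ccvg z l -> ccvg (fun n => conjc (z n)) (conjc l).
Proof.
move=> [zl1 zl2]; have aux (x : R[i]) : complex.Im (conjc x) = - complex.Im x.
  by case: x.
split.
  by rewrite Re_conjc; under eq_fun do rewrite Re_conjc.
by rewrite aux; under eq_fun do rewrite aux; exact: (@cvgN _ R^o).
Qed.

Lemma Re_le_sqmod (z : R[i]) : `|complex.Re z| <= Num.sqrt (sqmod z).
Proof.
rewrite -(sqrtr_sqr (complex.Re z)) ler_wsqrtr//.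
by rewrite /sqmod lerDl sqr_ge0.
Qed.

Lemma Im_le_sqmod (z : R[i]) : `|complex.Im z| <= Num.sqrt (sqmod z).
Proof.
rewrite -(sqrtr_sqr (complex.Im z)) ler_wsqrtr//.
by rewrite /sqmod lerDr sqr_ge0.
Qed.

Lemma ccvg_dist (z : nat -> R[i]) l (b : nat -> R) :
  (forall n, Num.sqrt (sqmod (z n - l)) <= b n) -> b @ \oo --> (0 : R) ->
  ccvg z l.
Proof.
move=> zb b0.
have aux (x y : R[i]) : complex.Re (x - y) = complex.Re x - complex.Re y /\
   complex.Im (x - y) = complex.Im x - complex.Im y.
  by case: x y => a1 b1 [c d].
suff H (x : nat -> R) (m : R) : (forall n, `|x n - m| <= b n) -> x @ \oo --> m.
  split; apply: H => n; apply: le_trans (zb n).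
    by rewrite -(aux _ _).1 Re_le_sqmod.
  by rewrite -(aux _ _).2 Im_le_sqmod.
move=> xb; apply/subr_cvg0; apply/norm_cvg0P.
apply: (@squeeze_cvgr _ _ _ _ (fun=> 0) b) => //; last exact: cvg_cst.
by near=> n; rewrite normr_ge0 /=; exact: xb.
Unshelve. all: by end_near.
Qed.

Lemma ccvg_limn z l : ccvg z l -> limn (z : nat -> R[i]^o) = l.
Proof.
move=> [zl1 zl2]; apply: (@cvg_lim R[i]^o); first exact: norm_hausdorff.
have dist_lt (r : R) (x y : R[i]) :
    `|complex.Re y - complex.Re x| < r -> `|complex.Im y - complex.Im x| < r ->
    Num.sqrt (sqmod (y - x)) < r + r.
  case: x y => a b [c d]; rewrite /sqmod /= => h1 h2.
  have r0 : 0 < r by apply: le_lt_trans h1.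
  rewrite -[ltRHS]ger0_norm ?addr_ge0 ?ltW// -[ltRHS]sqrtr_sqr.
  rewrite ltr_sqrt ?exprn_gt0 ?addr_gt0//.
  rewrite -(real_normK (num_real (c - a))) -(real_normK (num_real (d - b))).
  by move: (normr_ge0 (c - a)) (normr_ge0 (d - b)) h1 h2; nra.
apply/(@cvgrPdist_lt R[i] R[i]^o) => e e0.
have eE : e = (complex.Re e)%:C.
  by case: e e0 => a b; rewrite ltcE /= => /andP[/eqP-> _].
have {}e0 : 0 < complex.Re e / 2.
  by move: e0; rewrite ltcE /= => /andP[_ ?]; rewrite divr_gt0.
near=> n; rewrite normc_sqmod eE ltcR.
have h1 : `|complex.Re l - complex.Re (z n)| < complex.Re e / 2.
  by near: n; move/(@cvgrPdist_lt R R^o): zl1; apply.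
have h2 : `|complex.Im l - complex.Im (z n)| < complex.Re e / 2.
  by near: n; move/(@cvgrPdist_lt R R^o): zl2; apply.
by rewrite [ltRHS]splitr; exact: dist_lt.
Unshelve. all: by end_near.
Qed.

End Convergence.

(** * Norm convergence and completeness of the complexification *)

Section HilbertConvergence.
Context (R : realType) (V : completeNormedModType R) (ip : {dot V for idfun}).
Context {ip_norm : norm_of_dot ip}.
Local Notation H := (complexification V).
Local Notation dot := (hdot ip).
Local Notation nrm := (hnorm ip).
Implicit Types (u v w : H) (c : R[i]).

Lemma hnormD u v : nrm (u + v) <= nrm u + nrm v.
Proof.
rewrite -(@ler_pXn2r _ 2) ?nnegrE ?addr_ge0 ?hnorm_ge0//.
rewrite hnormD2 sqrrD lerD2r lerD2l -[leRHS]mulr_natl ler_pM2l//.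
apply: le_trans (ler_norm _) _; apply: le_trans (Re_le_sqmod _) _.
rewrite -[leRHS]ger0_norm ?mulr_ge0 ?hnorm_ge0// -sqrtr_sqr ler_wsqrtr//.
by rewrite exprMn; exact: hdot_CS.
Qed.

Lemma hnorm_dist u v w : nrm (u - w) <= nrm (u - v) + nrm (v - w).
Proof. by have := hnormD (u - v) (v - w); rewrite addrA subrK. Qed.

Lemma hdot_le u v : Num.sqrt (sqmod (dot u v)) <= nrm u * nrm v.
Proof.
rewrite -[leRHS]ger0_norm ?mulr_ge0 ?hnorm_ge0// -sqrtr_sqr ler_wsqrtr//.
by rewrite exprMn; exact: hdot_CS.
Qed.

(** The complexification is given an algebraic structure only, so convergence is stated through
    [hnorm]. *)
Definition hcvg (u : nat -> H) (l : H) : Prop :=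
  (fun n => nrm (u n - l)) @ \oo --> (0 : R).

Lemma hcvg_squeeze (u : nat -> H) l (b : nat -> R) :
  (forall n, nrm (u n - l) <= b n) -> b @ \oo --> (0 : R) -> hcvg u l.
Proof.
move=> ub b0.
apply: (@squeeze_cvgr _ _ _ _ (fun=> 0) b) => //; last exact: cvg_cst.
by near=> n; rewrite hnorm_ge0 /=; exact: ub.
Unshelve. all: by end_near.
Qed.

Lemma hcvgD (u v : nat -> H) l m : hcvg u l -> hcvg v m -> hcvg (fun n => u n + v n) (l + m).
Proof.
move=> ul vm; apply: (hcvg_squeeze (b := fun n => nrm (u n - l) + nrm (v n - m))).
  by move=> n; rewrite opprD addrACA hnormD.
by rewrite -(addr0 0); apply: (@cvgD _ R^o).
Qed.

Lemma hcvgZ c (u : nat -> H) l : hcvg u l -> hcvg (fun n => c *: u n) (c *: l).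
Proof.
move=> ul.
apply: (hcvg_squeeze (b := fun n => Num.sqrt (sqmod c) * nrm (u n - l))).
  by move=> n; rewrite -scalerBr hnormZ.
by rewrite -(mulr0 (Num.sqrt (sqmod c))); apply: cvgM => //; apply: cvg_cst.
Qed.

Lemma hcvg_dot (u : nat -> H) l w : hcvg u l -> ccvg (fun n => dot (u n) w) (dot l w).
Proof.
move=> ul; apply: (@ccvg_dist _ _ _ (fun n => nrm (u n - l) * nrm w)).
  by move=> n; rewrite -hdotBl hdot_le.
by rewrite -(mul0r (nrm w)); apply: cvgM => //; apply: cvg_cst.
Qed.

Lemma hcvg_unique (u : nat -> H) l m : hcvg u l -> hcvg u m -> l = m.
Proof.
move=> ul um; apply: (hdot_separates (ip := ip)) => w.
by rewrite !(hdotC ip _ w); congr conjc; apply: ccvg_unique; apply: hcvg_dot; eassumption.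
Qed.

Lemma hcvg_le (u : nat -> H) l (C : R) : (forall n, nrm (u n) <= C) -> hcvg u l -> nrm l <= C.
Proof.
move=> uC ul; have cv : (fun n => C + nrm (u n - l)) @ \oo --> C.
  by rewrite -[X in _ --> X]addr0; apply: (@cvgD _ R^o) => //; apply: cvg_cst.
apply: (cvgr_to_ge cv).
near=> n; rewrite hnormB; have := hnormD (u n) (l - u n).
by rewrite addrC subrK => /le_trans; apply; rewrite lerD2r.
Unshelve. all: by end_near.
Qed.

(** Both coordinates are 1-Lipschitz for [hnorm], so completeness of [V] yields the two components
    of the limit. *)
Lemma hcomplete (u : nat -> H) :
  (forall e : R, 0 < e -> exists N, forall m n, (N <= m)%N -> (N <= n)%N ->
     nrm (u m - u n) < e) ->
  exists l, hcvg u l.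
Proof.
move=> uC.
have cvgV (p : H -> V) : (forall v w, `|p v - p w| <= nrm (v - w)) ->
    cvg ((fun n => p (u n)) @ \oo).
  move=> pn; apply: cauchy_cvg; apply: cauchy_exP => e e0.
  have [N HN] := uC e e0; exists (p (u N)); exists N => //= n /= Nn.
  rewrite -ball_normE /=; apply: le_lt_trans (pn _ _) _.
  exact: HN.
have n1 (v : H) : `|v.1| <= nrm v /\ `|v.2| <= nrm v.
  by split; rewrite -(@ler_pXn2r _ 2) ?nnegrE ?hnorm_ge0//
    hnorm_pair ?lerDl ?lerDr sqr_ge0.
have c1 := cvgV fst (fun v w => (n1 (v - w)).1).
have c2 := cvgV snd (fun v w => (n1 (v - w)).2).
set l : H := (lim ((fun n => (u n).1) @ \oo), lim ((fun n => (u n).2) @ \oo)).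
exists l.
apply: (hcvg_squeeze (b := fun n => `|(u n).1 - l.1| + `|(u n).2 - l.2|)).
  move=> n; rewrite -(@ler_pXn2r _ 2) ?nnegrE ?hnorm_ge0 ?addr_ge0//.
  rewrite hnorm_pair sqrrD lerD2r lerDl mulrn_wge0// mulr_ge0//.
rewrite -(addr0 0); apply: (@cvgD _ R^o).
  by apply/norm_cvg0P/subr_cvg0.
by apply/norm_cvg0P/subr_cvg0.
Qed.

End HilbertConvergence.

Section LinearOn.
Context (R : realType) (V : completeNormedModType R).
Local Notation H := (complexification V).

Lemma linear_on0 (E : set H) (W : lmodType R[i]) (f : H -> W) : E 0 ->
  (forall c u v, E u -> E v -> f (c *: u + v) = c *: f u + f v) -> f 0 = 0.
Proof.
move=> E0 fl; have := fl (-1) 0 0 E0 E0.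
by rewrite !scaleN1r addr0 oppr0 addNr.
Qed.

(** Operators on a subspace are total functions constrained on [E] only, so membership of the
    partial sums is proved along with linearity. *)
Lemma linear_on_sum (E : set H) (W : lmodType R[i]) (f : H -> W)
    (e : nat -> H) (a : nat -> R[i]) n : E 0 ->
  (forall c u v, E u -> E v -> E (c *: u + v)) ->
  (forall c u v, E u -> E v -> f (c *: u + v) = c *: f u + f v) ->
  (forall k, E (e k)) ->
  E (\sum_(0 <= k < n) a k *: e k) /\
  f (\sum_(0 <= k < n) a k *: e k) = \sum_(0 <= k < n) a k *: f (e k).
Proof.
move=> E0 El fl Ee; elim: n => [|n [IE IH]].
  by rewrite !big_geq//; split=> //; exact: linear_on0 E0 fl.
rewrite !big_nat_recr//= ![_ + a n *: _]addrC; split; first exact: El.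
by rewrite fl// IH.
Qed.

End LinearOn.

(** * Fourier expansions, the Riesz theorem and adjoints *)

Section Bases.
Context (R : realType) (V : completeNormedModType R) (ip : {dot V for idfun}).
Context {ip_norm : norm_of_dot ip}.
Local Notation H := (complexification V).
Local Notation dot := (hdot ip).
Local Notation nrm := (hnorm ip).
Implicit Types (u v w : H) (c : R[i]) (E F : set H).

Record closed_subspace (E : set H) : Prop := ClosedSubspace {
  subspace0 : E 0;
  subspaceP : forall c u v, E u -> E v -> E (c *: u + v);
  subspace_cvg : forall (u : nat -> H) l, (forall n, E (u n)) ->
    hcvg ip u l -> E l }.

Lemma closed_subspaceT : closed_subspace setT.
Proof. by []. Qed.

Lemma subspaceB E u v : closed_subspace E -> E u -> E v -> E (u - v).
Proof.
by move=> cE Eu Ev; rewrite addrC -scaleN1r; exact: subspaceP.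
Qed.

Lemma subspaceZ E c u : closed_subspace E -> E u -> E (c *: u).
Proof.
by move=> cE Eu; rewrite -[_ *: _]addr0; apply: subspaceP => //; exact: subspace0.
Qed.

Lemma bounded_op_ge0 E F T : bounded_op ip E F T ->
  exists2 C : R, 0 <= C & forall u, E u -> nrm (T u) <= C * nrm u.
Proof.
move=> [_ _ [C HC]]; exists (Num.max C 0); first by rewrite le_max lexx orbT.
move=> u Eu; apply: le_trans (HC u Eu) _.
by rewrite ler_wpM2r ?hnorm_ge0// le_max lexx.
Qed.

Lemma hdot_separates_on E u v : closed_subspace E -> E u -> E v ->
  (forall w, E w -> dot w u = dot w v) -> u = v.
Proof.
move=> cE Eu Ev uv; apply/eqP; rewrite -subr_eq0; apply/eqP/hnorm0_eq0.
apply/eqP; rewrite -sqrf_eq0 hnormE hdotBr uv ?subrr//=.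
exact: subspaceB.
Qed.

Section Orthonormal.
Context (e : nat -> H) (e_on : forall m n, dot (e m) (e n) = (m == n)%:R).
Local Notation psum a n := (\sum_(0 <= k < n) a k *: e k).

Lemma psum_dot (a : nat -> R[i]) n m :
  dot (psum a n) (e m) = if (m < n)%N then a m else 0.
Proof.
rewrite hdot_suml; elim: n => [|n IH]; first by rewrite big_geq.
rewrite big_nat_recr//= IH hdotZl e_on eq_sym [in RHS]ltnS [in RHS]leq_eqVlt.
case: (eqVneq m n) => [->|mn]; first by rewrite ltnn mulr1 add0r.
by rewrite mulr0 addr0 /=.
Qed.

Lemma hdot_psum (a : nat -> R[i]) u n :
  dot u (psum a n) = \sum_(0 <= k < n) conjc (a k) * dot u (e k).
Proof. by rewrite hdot_sumr; apply: eq_bigr => k _; rewrite hdotZr. Qed.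

Lemma psum_psum (a : nat -> R[i]) m n : (m <= n)%N ->
  dot (psum a n) (psum a m) = (\sum_(0 <= k < m) sqmod (a k))%:C.
Proof.
move=> mn; rewrite hdot_psum rmorph_sum /=.
apply: eq_big_nat => k /andP[_ km]; rewrite psum_dot (leq_trans km mn).
by rewrite mulrC mulc_conj.
Qed.

Lemma psum_norm (a : nat -> R[i]) n :
  nrm (psum a n) ^+ 2 = \sum_(0 <= k < n) sqmod (a k).
Proof. by rewrite hnormE psum_psum. Qed.

Lemma psum_dist (a : nat -> R[i]) m n : (m <= n)%N ->
  nrm (psum a n - psum a m) ^+ 2 =
  \sum_(0 <= k < n) sqmod (a k) - \sum_(0 <= k < m) sqmod (a k).
Proof.
move=> mn; rewrite hnormD2 hnormN hdotNr psum_psum// !psum_norm /=; ring.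
Qed.

(** Pythagoras. Nonnegativity of the left side gives Bessel's inequality, its convergence to 0 gives
    Parseval's identity. *)
Lemma bessel_dist u n :
  nrm (u - psum (fun k => dot u (e k)) n) ^+ 2 =
  nrm u ^+ 2 - \sum_(0 <= k < n) sqmod (dot u (e k)).
Proof.
rewrite hnormD2 hnormN psum_norm hdotNr hdot_psum.
rewrite (eq_bigr (fun k => (sqmod (dot u (e k)))%:C)); last first.
  by move=> k _; rewrite mulrC mulc_conj.
by rewrite -rmorph_sum /=; ring.
Qed.

Lemma bessel u n : \sum_(0 <= k < n) sqmod (dot u (e k)) <= nrm u ^+ 2.
Proof. by rewrite -subr_ge0 -bessel_dist sqr_ge0. Qed.

(** The squared distance of two partial sums is a difference of terms of a bounded increasing
    sequence, so they form a Cauchy sequence. *)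
Lemma riesz_fischer (a : nat -> R[i]) (K : R) :
  (forall n, \sum_(0 <= k < n) sqmod (a k) <= K) ->
  exists2 w, hcvg ip (fun n => psum a n) w & forall k, dot w (e k) = a k.
Proof.
move=> aK; pose S n := \sum_(0 <= k < n) sqmod (a k).
have Sincr : nondecreasing_seq S.
  apply/nondecreasing_seqP => n; rewrite /S big_nat_recr//= lerDl.
  exact: sqmod_ge0.
have Scvg : cvgn S.
  by apply: nondecreasing_is_cvgn => //; exists K => _ [n _ <-]; exact: aK.
have [|w ww] := hcomplete (ip := ip) (u := fun n => psum a n).
  move=> eps eps0.
  have e2 : 0 < eps ^+ 2 by rewrite exprn_gt0.
  have [N _ HN] : \forall n \near \oo, `|limn S - S n| < eps ^+ 2.
    by move/(@cvgrPdist_lt R R^o): (Scvg); apply.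
  have W m n : (N <= m)%N -> (m <= n)%N -> nrm (psum a n - psum a m) < eps.
    move=> Nm mn; rewrite -(@ltr_pXn2r _ 2) ?nnegrE ?hnorm_ge0 ?ltW//.
    rewrite psum_dist//; have := HN m Nm; have := nondecreasing_cvgn_le Sincr Scvg n.
    rewrite -/(S n) -/(S m) /= => h1 /ltr_normlW; lra.
  exists N => m n Nm Nn; case: (leqP n m) => [nm|/ltnW mn]; first exact: W.
  by rewrite hnormB; exact: W.
exists w => // k; apply: (ccvg_unique (hcvg_dot (e k) ww)).
under eq_fun do rewrite psum_dot.
have aux (p : R[i] -> R) :
    (fun n => p (if (k < n)%N then a k else 0)) @ \oo --> p (a k).
  apply: cvg_near_cst; near=> n; rewrite ifT//; near: n.
  by exists k.+1.
by split; exact: aux.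
Unshelve. all: by end_near.
Qed.

End Orthonormal.

Section HilbertBasis.
Context (E : set H) (cE : closed_subspace E).
Context (e : nat -> H) (eB : hilbert_basis ip E e).

Let e_on : forall m n, dot (e m) (e n) = (m == n)%:R. Proof. by case: eB. Qed.
Let eE n : E (e n). Proof. by case: eB. Qed.

(** Riesz-Fischer produces [w] in [E] with the Fourier coefficients of [u]; then [u - w] is
    orthogonal to the whole basis and vanishes by maximality. *)
Lemma fourier_cvg u : E u ->
  hcvg ip (fun n => \sum_(0 <= k < n) dot u (e k) *: e k) u.
Proof.
move=> Eu; have [w ww wk] := riesz_fischer e_on (bessel e_on u).
suff wu : u = w by rewrite -wu in ww.
have Ew : E w.
  apply: (subspace_cvg cE) ww => n.
  by apply: (linear_on_sum (f := id) _ _ (subspace0 cE) (subspaceP cE) _ eE).1.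
apply/eqP; rewrite -subr_eq0; apply/eqP.
case: eB => _ _; apply; first exact: subspaceB.
by move=> n; rewrite hdotBl wk subrr.
Qed.

Lemma parseval u : E u ->
  (fun n => \sum_(0 <= k < n) sqmod (dot u (e k))) @ \oo --> nrm u ^+ 2.
Proof.
move=> /fourier_cvg uu.
rewrite [X in X @ _ --> _](_ : _ = fun n => nrm u ^+ 2 -
   nrm ((\sum_(0 <= k < n) dot u (e k) *: e k) - u) ^+ 2); last first.
  by apply/funext => n; rewrite hnormB bessel_dist//; ring.
rewrite -[X in _ --> X]subr0; apply: (@cvgB _ R^o); first exact: cvg_cst.
by rewrite -[X in _ --> X](mulr0 0); under eq_fun do rewrite expr2; exact: cvgM.
Qed.

Lemma parseval_hdot u v : E u ->
  ccvg (fun n => \sum_(0 <= k < n) dot u (e k) * dot (e k) v) (dot u v).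
Proof.
move=> /fourier_cvg/(hcvg_dot v).
by under eq_fun do [rewrite hdot_suml; under eq_bigr do rewrite hdotZl].
Qed.

(** The representing vector has coefficients [conjc (f (e k))], and Riesz-Fischer builds it once
    these are square summable. *)
Lemma riesz (f : H -> R[i]) (C : R) :
  (forall c u v, E u -> E v -> f (c *: u + v) = c * f u + f v) ->
  (forall u, E u -> Num.sqrt (sqmod (f u)) <= C * nrm u) ->
  exists2 w, E w & forall u, E u -> f u = dot u w.
Proof.
move=> fl fC.
have f_sum := linear_on_sum (W := R[i]^o) (f := f) _ _ (subspace0 cE) (subspaceP cE) fl eE.
pose a k := conjc (f (e k)).
have aC n : \sum_(0 <= k < n) sqmod (a k) <= C ^+ 2.
  have [Es fs] := f_sum a n.
  set S := \sum_(0 <= k < n) _.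
  have S0 : 0 <= S by apply: sumr_ge0 => *; exact: sqmod_ge0.
  have sS : nrm (\sum_(0 <= k < n) a k *: e k) ^+ 2 = S by rewrite psum_norm.
  have fS : f (\sum_(0 <= k < n) a k *: e k) = S%:C.
    rewrite fs rmorph_sum /=; apply: eq_bigr => k _.
    by rewrite -(conjcK (f (e k))) -mulc_conj.
  (* On the partial sum, whose squared norm is [S], the value of [f] is [S]; boundedness gives
     [S <= C sqrt S], hence [S <= C^2]. *)
  have := fC _ Es; rewrite fS sqmod_real sqrtr_sqr ger0_norm//.
  move: (hnorm_ge0 ip (\sum_(0 <= k < n) a k *: e k)) sS.
  set x := nrm _ => x0 <- xC; nra.
have [w ww wk] := riesz_fischer e_on aC.
have Ew : E w by apply: (subspace_cvg cE) ww => n; exact: (f_sum a n).1.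
exists w => // u Eu.
have uu := fourier_cvg Eu.
apply: (ccvg_unique _ (hcvg_dot w uu)).
have -> : (fun n => dot (\sum_(0 <= k < n) dot u (e k) *: e k) w) =
   fun n => f (\sum_(0 <= k < n) dot u (e k) *: e k).
  apply/funext => n; rewrite (f_sum _ n).2 hdot_suml; apply: eq_bigr => k _.
  by rewrite hdotZl (hdotC ip w) wk /a conjcK.
apply: (@ccvg_dist _ _ _ (fun n =>
   C * nrm (\sum_(0 <= k < n) dot u (e k) *: e k - u))).
  move=> n; have Es := (f_sum (fun k => dot u (e k)) n).1.
  apply: le_trans (fC _ (subspaceB cE Es Eu)).
  by rewrite [_ - u]addrC -[- u]scaleN1r fl// mulN1r addrC.
by rewrite -[X in _ --> X](mulr0 C); apply: cvgM => //; apply: cvg_cst.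
Qed.

(** Riesz applied to [u |-> <T u, w>] for each [w]. Since [T'] is defined on all of [H] with values
    in [E], [T' \o T] is an operator on [E], as needed for [|T|]. *)
Lemma adjoint_on F (T : H -> H) : bounded_op ip E F T ->
  exists2 T', bounded_op ip setT E T' &
    forall u w, E u -> dot (T u) w = dot u (T' w).
Proof.
move=> bT; have [_ Tl _] := bT; have [C C0 TC] := bounded_op_ge0 bT.
have /choice[T' T'P] w : exists w', E w' /\ forall u, E u -> dot (T u) w = dot u w'.
  have [||w' Ew' w'P] := @riesz (fun u => dot (T u) w) (C * nrm w).
  - by move=> c u v Eu Ev; rewrite Tl// hdotDl hdotZl.
  - move=> u Eu; apply: le_trans (hdot_le _ _) _.
    by rewrite mulrAC ler_wpM2r ?hnorm_ge0// TC.
  by exists w'.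
exists T'; last by move=> u w; exact: (T'P w).2.
split=> [u _|c u v _ _|]; first exact: (T'P u).1.
  apply: (hdot_separates_on cE); first exact: (T'P _).1.
    by apply: (subspaceP cE); exact: (T'P _).1.
  by move=> w Ew; rewrite -(T'P _).2// !hdotDr !hdotZr -!(T'P _).2.
(* [|T' u|^2 = <T (T' u), u> <= C |T' u| |u|]; the case [T' u = 0] is set apart before dividing. *)
exists C => u _; have [T'u T'uP] := T'P u.
have := hdot_le (ip_norm := ip_norm) (T (T' u)) u.
rewrite T'uP// hdotuu sqmod_real sqrtr_sqr ger0_norm ?sqr_ge0// => h.
have := TC _ T'u => h2; have := hnorm_ge0 ip (T' u); have := hnorm_ge0 ip u.
rewrite le_eqVlt => u0; rewrite le_eqVlt => /orP[/eqP <-|T0].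
  by rewrite mulr_ge0 ?hnorm_ge0.
rewrite -(ler_pM2l T0) -expr2; apply: le_trans h _.
apply: le_trans (ler_wpM2r (hnorm_ge0 _ _) h2) _.
by rewrite mulrAC mulrC.
Qed.

End HilbertBasis.
End Bases.

(** * Positive operators, square roots and absolute values *)

Section PositiveOperators.
Context (R : realType) (V : completeNormedModType R) (ip : {dot V for idfun}).
Context {ip_norm : norm_of_dot ip}.
Local Notation H := (complexification V).
Local Notation dot := (hdot ip).
Local Notation nrm := (hnorm ip).
Implicit Types (u v w : H) (c : R[i]).
Context (E : set H) (cE : closed_subspace ip E).

Section Positive.
Context (P : H -> H).
Hypothesis Pl : forall c u v, E u -> E v -> P (c *: u + v) = c *: P u + P v.
Hypothesis Pge0 : forall u, E u -> 0 <= dot (P u) u.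

(** The form is real on the diagonal; expanding it at [u + v] and at [i u + v] gives the two real
    equations of Hermitian symmetry. *)
Lemma positive_hermitian u v : E u -> E v -> dot (P v) u = conjc (dot (P u) v).
Proof.
move=> Eu Ev.
have Pim w : E w -> complex.Im (dot (P w) w) = 0.
  by move=> /Pge0; rewrite lecE => /andP[/eqP].
have K c : complex.Im (c * dot (P u) v + conjc c * dot (P v) u) = 0.
  have aux (p q x y : R[i]) : complex.Im p = 0 -> complex.Im q = 0 ->
      complex.Im (c * (conjc c * p + x) + (conjc c * y + q)) = 0 ->
      complex.Im (c * x + conjc c * y) = 0.
    by case: c p q x y => a b [a1 b1] [a2 b2] [a3 b3] [a4 b4] /= -> -> <-; ring.
  apply: aux (Pim u Eu) (Pim v Ev) _.
  have := Pim (c *: u + v) (subspaceP cE _ Eu Ev).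
  by rewrite Pl// hdotDr !hdotDl !hdotZr !hdotZl => <-; congr complex.Im; ring.
move: (K 1) (K 'i%C); move: (dot (P u) v) (dot (P v) u) => [a1 b1] [a2 b2] /=.
by move=> h1 h2; congr (_ +i* _); lra.
Qed.

(** Used with [P = |T|] to compare the trace norm with the Hilbert-Schmidt norm, and with
    [1 - T^* T / C^2] to see that the latter is a contraction. *)
Lemma positive_CS u v : E u -> E v ->
  sqmod (dot (P u) v) <= complex.Re (dot (P u) u) * complex.Re (dot (P v) v).
Proof.
move=> Eu Ev; rewrite mulrC.
have PRe w : E w -> 0 <= complex.Re (dot (P w) w).
  by move=> /Pge0; rewrite lecE => /andP[].
apply: quadratic_form_discr => [|c]; first exact: PRe.
have aux (p q x : R[i]) : complex.Im p = 0 ->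
    complex.Re (c * (conjc c * p + x) + (conjc c * conjc x + q)) =
    complex.Re q + 2 * complex.Re (c * x) + sqmod c * complex.Re p.
  by case: c p q x => a b [a1 b1] [a2 b2] [a3 b3] /= ->; rewrite /sqmod /=; ring.
have Im0 : complex.Im (dot (P u) u) = 0.
  by have := Pge0 Eu; rewrite lecE => /andP[/eqP].
rewrite -aux// -(positive_hermitian Eu Ev).
have := PRe (c *: u + v) (subspaceP cE _ Eu Ev).
rewrite Pl// hdotDr !hdotDl !hdotZr !hdotZl => /le_trans; apply.
by rewrite le_eqVlt; apply/orP; left; apply/eqP; congr complex.Re; ring.
Qed.

End Positive.

(* The square root is [1 - S] where S solves [2 S = X + S^2]; the scalar
   sequence [sqrt_scalar] dominates the iterates and their increments. *)
Section SquareRoot.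
Context (X : H -> H).
Hypothesis XE : forall u, E u -> E (X u).
Hypothesis Xl : forall c u v, E u -> E v -> X (c *: u + v) = c *: X u + X v.
Hypothesis Xsa : forall u v, E u -> E v -> dot (X u) v = dot u (X v).
Hypothesis X1 : forall u, E u -> nrm (X u) <= nrm u.

Fixpoint sqrt_iter (n : nat) (u : H) : H :=
  if n is m.+1 then (2^-1)%:C *: (X u + sqrt_iter m (sqrt_iter m u)) else 0.

Fixpoint sqrt_scalar (n : nat) : R :=
  if n is m.+1 then (1 + sqrt_scalar m ^+ 2) / 2 else 0.

Local Notation S := sqrt_iter.
Local Notation t := sqrt_scalar.

Let t_bound n : 0 <= t n <= 1.
Proof. by elim: n => [|n /andP[h1 h2]] /=; apply/andP; split=> //; nra. Qed.

Let t_incr n : t n <= t n.+1.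
Proof. by have := t_bound n; rewrite /= => /andP[h1 h2]; nra. Qed.

Let nrm_half u : nrm ((2^-1)%:C *: u) = nrm u / 2.
Proof. by rewrite hnormZ sqmod_real sqrtr_sqr ger0_norm// mulrC. Qed.

Let S_E n u : E u -> E (S n u).
Proof.
elim: n u => [|n IH] u Eu /=; first exact: (subspace0 cE).
apply: (subspaceZ _ cE); rewrite -[X u]scale1r.
by apply: (subspaceP cE); [exact: XE|exact/IH/IH].
Qed.

Let S_lin n c u v : E u -> E v -> S n (c *: u + v) = c *: S n u + S n v.
Proof.
elim: n c u v => [|n IH] c u v Eu Ev /=; first by rewrite scaler0 addr0.
rewrite Xl// IH// (IH _ _ _ (S_E n Eu) (S_E n Ev)).
by rewrite addrACA -[c *: X u + _]scalerDr [LHS]scalerDr !scalerA mulrC.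
Qed.

Let S_sa n u v : E u -> E v -> dot (S n u) v = dot u (S n v).
Proof.
elim: n u v => [|n IH] u v Eu Ev /=; first by rewrite hdot0l hdot0r.
rewrite hdotZl hdotZr conjc_real hdotDl hdotDr Xsa//.
by rewrite (IH _ _ (S_E n Eu) Ev) (IH _ _ Eu (S_E n Ev)).
Qed.

Let S_norm n u : E u -> nrm (S n u) <= t n * nrm u.
Proof.
elim: n u => [|n IH] u Eu /=; first by rewrite hnorm0 mul0r.
rewrite nrm_half mulrAC ler_pM2r ?invr_gt0//.
apply: le_trans (hnormD _ _) _; rewrite mulrDl mul1r lerD//; first exact: X1.
apply: le_trans (IH _ (S_E _ Eu)) _; rewrite expr2 -mulrA ler_wpM2l//; last exact: IH.
by case/andP: (t_bound n).
Qed.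

Let S_B n u v : E u -> E v -> S n (u - v) = S n u - S n v.
Proof.
by move=> Eu Ev; rewrite addrC -scaleN1r S_lin// scaleN1r addrC.
Qed.

Let S_incr n u : E u -> nrm (S n.+1 u - S n u) <= (t n.+1 - t n) * nrm u.
Proof.
elim: n u => [|n IH] u Eu.
  rewrite /= subr0 addr0 nrm_half subr0 expr0n addr0 mul1r [leRHS]mulrC.
  by rewrite ler_pM2r ?invr_gt0// X1.
(* [S_{n+1}^2 - S_n^2 = S_{n+1} (S_{n+1} - S_n) + (S_{n+1} - S_n) S_n], while the terms in [X]
   cancel. *)
have -> : S n.+2 u - S n.+1 u = (2^-1)%:C *: (S n.+1 (S n.+1 u - S n u) +
    (S n.+1 (S n u) - S n (S n u))).
  rewrite (S_B _ (S_E n.+1 Eu) (S_E n Eu)) addrA subrK.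
  rewrite -[S n.+2 u]/(_ *: _) -{2}[S n.+1 u]/(_ *: _).
  by rewrite -scalerBr opprD addrACA subrr add0r.
rewrite nrm_half ler_pdivrMr//; apply: le_trans (hnormD _ _) _.
have h1 := IH u Eu; have h2 := IH _ (S_E n Eu).
have h3 := S_norm n.+1 (subspaceB cE (S_E n.+1 Eu) (S_E n Eu)).
have h4 := S_norm n Eu.
have /andP[t0 _] := t_bound n.+1; have ti := t_incr n.
have h5 : nrm (S n.+1 (S n.+1 u - S n u)) <= t n.+1 * ((t n.+1 - t n) * nrm u).
  by apply: le_trans h3 _; rewrite ler_wpM2l.
have h6 : nrm (S n.+1 (S n u) - S n (S n u)) <= (t n.+1 - t n) * (t n * nrm u).
  by apply: le_trans h2 _; rewrite ler_wpM2l ?subr_ge0.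
(* The scalar sequence obeys the recursion with [X] replaced by 1, so for its increments the same
   decomposition is an equality. *)
apply: le_trans (lerD h5 h6) _; rewrite le_eqVlt; apply/orP; left; apply/eqP.
by rewrite [t n.+2]/= [in RHS](_ : t n.+1 = (1 + t n ^+ 2) / 2)//=; field.
Qed.

Let S_dist m n u : (m <= n)%N -> E u ->
  nrm (S n u - S m u) <= (t n - t m) * nrm u.
Proof.
move=> + Eu; elim: n => [|n IH]; first by rewrite leqn0 => /eqP->; rewrite !subrr hnorm0 mul0r.
rewrite leq_eqVlt => /orP[/eqP->|mn]; first by rewrite !subrr hnorm0 mul0r.
apply: le_trans (hnorm_dist _ (S n u) _) _.
apply: le_trans (lerD (S_incr n Eu) (IH mn)) _.
by rewrite -mulrDl addrA subrK.
Qed.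

(** The scalar sequence increases and is bounded by 1, so the iterates are Cauchy at every vector of
    [E]. Linearity, symmetry, the contraction bound and the recursion pass to the pointwise
    limit. *)
Lemma sqrt_limit : exists S' : H -> H,
  [/\ forall u, E u -> E (S' u),
      forall c u v, E u -> E v -> S' (c *: u + v) = c *: S' u + S' v,
      forall u v, E u -> E v -> dot (S' u) v = dot u (S' v),
      forall u, E u -> nrm (S' u) <= nrm u
    & forall u, E u -> 2%:C *: S' u = X u + S' (S' u)].
Proof.
have t_mono : nondecreasing_seq t by apply/nondecreasing_seqP.
have tcvg : cvgn t.
  apply: nondecreasing_is_cvgn => //; exists 1 => _ [n _ <-].
  by case/andP: (t_bound n).
(* The condition [E u] sits inside the existential so that a choice function exists on all of
   [H]. *)
have lim_ex u : exists l, E u -> hcvg ip (fun n => S n u) l.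
  have [Eu|nEu] := pselect (E u); last by exists 0.
  have [|l ll] := @hcomplete _ _ ip ip_norm (fun n => S n u); last by exists l.
  move=> eps eps0.
  have d0 : 0 < eps / (nrm u + 1) by rewrite divr_gt0 ?ltr_wpDl ?hnorm_ge0.
  have [N _ HN] : \forall n \near \oo, `|limn t - t n| < eps / (nrm u + 1).
    by move/(@cvgrPdist_lt R R^o): (tcvg); apply.
  have W m n : (N <= m)%N -> (m <= n)%N -> nrm (S n u - S m u) < eps.
    move=> Nm mn; apply: le_lt_trans (S_dist mn Eu) _.
    have := HN m Nm; rewrite ltr_pdivlMr ?ltr_wpDl ?hnorm_ge0//.
    have := nondecreasing_cvgn_le t_mono tcvg n; have := t_mono _ _ mn.
    rewrite /= => h1 h2; rewrite ger0_norm; last first.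
      by rewrite subr_ge0; exact: le_trans h1 h2.
    by move: (hnorm_ge0 ip u) => h3; nra.
  exists N => m n Nm Nn; case: (leqP n m) => [nm|/ltnW mn]; first exact: W.
  by rewrite hnormB; exact: W.
have /choice[S' S'P] := lim_ex.
have S'E u : E u -> E (S' u).
  by move=> Eu; apply: (subspace_cvg cE) (S'P _ Eu) => n; exact: S_E.
exists S'; split=> //.
- move=> c u v Eu Ev; apply: hcvg_unique (S'P _ (subspaceP cE _ Eu Ev)) _.
  rewrite (_ : (fun n => _) = fun n => c *: S n u + S n v).
    by apply: hcvgD; [exact/hcvgZ/S'P|exact: S'P].
  by apply/funext => n; rewrite S_lin.
- move=> u v Eu Ev; apply: ccvg_unique (hcvg_dot v (S'P _ Eu)) _.
  rewrite (_ : (fun n => _) = fun n => conjc (dot (S n v) u)).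
    by rewrite hdotC; apply: ccvgJ; apply: hcvg_dot; exact: S'P.
  by apply/funext => n; rewrite S_sa// [LHS]hdotC.
- move=> u Eu; apply: hcvg_le (S'P _ Eu) => n.
  apply: le_trans (S_norm n Eu) _; have /andP[_ ?] := t_bound n.
  by rewrite ler_piMl ?hnorm_ge0.
- move=> u Eu.
  (* The uniform bound [|S_n v| <= |v|] allows both occurrences of [S n] to go to the limit
     together. *)
  have h1 : hcvg ip (fun n => S n (S n u)) (S' (S' u)).
    apply: (@hcvg_squeeze _ _ _ _ _
      (fun n => nrm (S n u - S' u) + nrm (S n (S' u) - S' (S' u)))).
      move=> n; apply: le_trans (hnorm_dist _ (S n (S' u)) _) _.
      rewrite lerD2r -(S_B _ (S_E n Eu) (S'E _ Eu)).
      apply: le_trans (S_norm _ (subspaceB cE (S_E n Eu) (S'E _ Eu))) _.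
      have /andP[_ ?] := t_bound n; by rewrite ler_piMl ?hnorm_ge0.
    rewrite -[X in _ --> X]addr0; apply: (@cvgD _ R^o); first exact: (S'P _ Eu).
    exact: (S'P _ (S'E _ Eu)).
  have h2 : hcvg ip (fun n => 2%:C *: S n.+1 u) (X u + S' (S' u)).
    rewrite (_ : (fun n => _) = fun n => X u + S n (S n u)).
      apply: hcvgD h1; rewrite /hcvg subrr hnorm0; exact: cvg_cst.
    apply/funext => n; rewrite /= scalerA -rmorphM /= divff ?pnatr_eq0//.
    by rewrite scale1r.
  apply: hcvg_unique h2; apply: hcvgZ.
  by have := S'P _ Eu; rewrite /hcvg -cvg_shiftS.
Qed.

End SquareRoot.

(** With [B = T^* T] and [C] above the norm of [T], [X = 1 - B / C^2] is a positive contraction. The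
    equation [2 S = X + S^2] says [(1 - S)^2 = 1 - X], so [C (1 - S)] squares to [B]. *)
Lemma absop_exists (e : nat -> H) F (T : H -> H) : hilbert_basis ip E e ->
  bounded_op ip E F T -> exists P, is_absop ip E T P.
Proof.
move=> eB bT; have [T' [T'E T'l _] T'P] := adjoint_on cE eB bT.
have [_ Tl _] := bT; have [C0 C00 TC0] := bounded_op_ge0 bT.
pose C := C0 + 1; have C1 : 0 < C by rewrite ltr_wpDl.
have TC u : E u -> nrm (T u) <= C * nrm u.
  move=> /TC0 /le_trans; apply; rewrite ler_wpM2r ?hnorm_ge0//.
  by rewrite lerDl.
pose B u := T' (T u).
have BP u v : E u -> E v -> dot (B u) v = dot (T u) (T v).
  by move=> Eu Ev; rewrite hdotC -T'P// -hdotC.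
have BE u : E (B u) by exact: T'E.
have Bl c u v : E u -> E v -> B (c *: u + v) = c *: B u + B v.
  by move=> Eu Ev; rewrite /B Tl// T'l.
pose X u : H := u - (C ^- 2)%:C *: B u.
have XE u : E u -> E (X u).
  by move=> Eu; apply: (subspaceB cE) => //; exact: (subspaceZ _ cE).
have Xl c u v : E u -> E v -> X (c *: u + v) = c *: X u + X v.
  move=> Eu Ev; rewrite /X Bl// scalerBr scalerDr opprD addrACA !scalerA.
  by rewrite [c * _]mulrC.
have Xsa u v : E u -> E v -> dot (X u) v = dot u (X v).
  move=> Eu Ev; rewrite /X hdotBl hdotBr hdotZl hdotZr conjc_real BP//.
  by rewrite (hdotC ip (B v)) BP// -hdotC.
have XRe u : E u -> dot (X u) u = (nrm u ^+ 2 - C ^- 2 * nrm (T u) ^+ 2 : R)%:C.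
  by move=> Eu; rewrite hdotBl hdotZl BP// !hdotuu -rmorphM -rmorphB.
have X_ge0 u : E u -> 0 <= dot (X u) u.
  move=> Eu; rewrite XRe//; apply: real_complex_ge0.
  suff : C ^- 2 * nrm (T u) ^+ 2 <= nrm u ^+ 2 by rewrite -subr_ge0.
  rewrite mulrC ler_pdivrMr ?exprn_gt0//.
  rewrite mulrC -exprMn ler_pXn2r ?nnegrE ?mulr_ge0 ?hnorm_ge0 ?TC//.
  exact: ltW.
have X_le u : E u -> complex.Re (dot (X u) u) <= nrm u ^+ 2.
  move=> Eu; rewrite XRe//= lerBlDr lerDl mulr_ge0 ?sqr_ge0//.
  by rewrite invr_ge0 sqr_ge0.
(* Cauchy-Schwarz for the form of [X]: [|X u|^4 <= <X u, u> <X (X u), X u> <= |u|^2 |X u|^2]. *)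
have X1 u : E u -> nrm (X u) <= nrm u.
  move=> Eu; have := positive_CS Xl X_ge0 Eu (XE _ Eu).
  rewrite hdotuu sqmod_real => h; have h1 := X_le _ Eu; have h2 := X_le _ (XE _ Eu).
  have p1 : 0 <= complex.Re (dot (X u) u).
    by have := X_ge0 _ Eu; rewrite lecE => /andP[].
  have p2 : 0 <= complex.Re (dot (X (X u)) (X u)).
    by have := X_ge0 _ (XE _ Eu); rewrite lecE => /andP[].
  have := hnorm_ge0 ip (X u); rewrite le_eqVlt => /orP[/eqP <-|n0].
    exact: hnorm_ge0.
  rewrite -(@ler_pXn2r _ 2) ?nnegrE ?hnorm_ge0//.
  rewrite -(ler_pM2r (exprn_gt0 2 n0)) -expr2; apply: le_trans h _.
  exact: ler_pM.
have [S [SE Sl Ssa S1 SS]] := sqrt_limit XE Xl Xsa X1.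
exists (fun u => C%:C *: (u - S u)); split.
- split.
  + by move=> u Eu; apply: (subspaceZ _ cE); apply: (subspaceB cE) => //; exact: SE.
  + move=> c u v Eu Ev; rewrite Sl// opprD addrACA -scalerBr scalerDr.
    by rewrite !scalerA mulrC.
  + exists (C * 2) => u Eu; rewrite hnormZ sqmod_real sqrtr_sqr gtr0_norm//.
    rewrite -mulrA ler_pM2l//; apply: le_trans (hnormD _ _) _.
    by rewrite hnormN mulr2n mulrDl mul1r lerD2l S1.
- move=> u Eu; rewrite hdotZl hdotBl.
  have Sr : dot (S u) u = (complex.Re (dot (S u) u))%:C.
    have := Ssa u u Eu Eu; rewrite [in X in _ = X -> _]hdotC.
    case: (dot (S u) u) => a b /= [h]; congr (_ +i* _); lra.
  have Sle : complex.Re (dot (S u) u) <= nrm u ^+ 2.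
    apply: le_trans (ler_norm _) _; apply: le_trans (Re_le_sqmod _) _.
    apply: le_trans (hdot_le _ _) _; rewrite expr2 ler_wpM2r ?hnorm_ge0//.
    exact: S1.
  rewrite Sr hdotuu -rmorphB -rmorphM; apply: real_complex_ge0.
  by apply: mulr_ge0; [exact: ltW|rewrite -subr_ge0 in Sle].
- move=> u v Eu Ev; rewrite -BP//; congr dot.
  have SB w w' : E w -> E w' -> S (w - w') = S w - S w'.
    by move=> Ew Ew'; rewrite addrC -scaleN1r Sl// scaleN1r addrC.
  have SZ c w : E w -> S (c *: w) = c *: S w.
    move=> Ew; have := Sl c w 0 Ew (subspace0 cE).
    by rewrite addr0 (linear_on0 (subspace0 cE) Sl) addr0.
  have Eu' := subspaceB cE Eu (SE _ Eu).
  rewrite (SZ _ _ Eu') (SB _ _ Eu (SE _ Eu)) -scalerBr scalerA -rmorphM.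
  have -> : u - S u - (S u - S (S u)) = u - X u.
    have -> : X u = S u + S u - S (S u).
      rewrite -[X u](addrK (S (S u))) -SS// (_ : 2%:C = 1 + 1).
        by rewrite scalerDl scale1r.
      by rewrite -rmorphD.
    by rewrite -addrA -opprD addrA.
  rewrite /X opprB addrC subrK scalerA -rmorphM -expr2 divff ?scale1r//.
  by rewrite sqrf_eq0 gt_eqF.
Qed.

End PositiveOperators.

(** * Existence of countably infinite Hilbert bases *)

Section BasisExistence.
Context (R : realType) (V : completeNormedModType R) (ip : {dot V for idfun}).
Context {ip_norm : norm_of_dot ip}.
Local Notation H := (complexification V).
Local Notation dot := (hdot ip).
Local Notation nrm := (hnorm ip).
Implicit Types (u v w : H) (c : R[i]).

Definition orthonormal_set (A : set H) : Prop :=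
  forall a b, A a -> A b -> dot a b = (a == b)%:R.

(** By Zorn: two vectors in the union of a chain already lie in one member of it. A nonzero vector
    orthogonal to a maximal set could be normalized and added. *)
Lemma maximal_orthonormal_set (E : set H) : closed_subspace ip E ->
  exists A, [/\ A `<=` E, orthonormal_set A
    & forall u, E u -> (forall a, A a -> dot u a = 0) -> u = 0].
Proof.
move=> cE.
have [F FP Ftot|A [[AE AO] Amax]] :=
    @Zorn_bigcup H [set A | A `<=` E /\ orthonormal_set A].
  split; first by move=> u [X FX Xu]; exact: (FP X FX).1.
  move=> a b [X FX Xa] [Y FY Yb].
  by have [XY|YX] := Ftot _ _ FX FY;
    [apply: (FP Y FY).2 => //; exact: XY|apply: (FP X FX).2 => //; exact: YX].
exists A; split=> // u Eu uA; apply: contrapT => u0.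
have nu : 0 < nrm u.
  rewrite lt_neqAle hnorm_ge0 andbT eq_sym; apply/eqP.
  by move=> /hnorm0_eq0.
pose w : H := (nrm u)^-1%:C *: u.
have ww : dot w w = 1.
  rewrite hdotuu hnormZ2 sqmod_real -exprMn mulVf ?expr1n//.
  by rewrite gt_eqF.
have wA a : A a -> dot w a = 0 by move=> Aa; rewrite hdotZl uA// mulr0.
have nAw : ~ A w by move=> /wA; rewrite ww => /eqP; rewrite oner_eq0.
have Aw0 a : A a -> (a == w) = false by move=> Aa; apply/eqP => aw; rewrite aw in Aa.
apply: (Amax (A `|` [set w])).
  split; first by move=> a Aa; left.
  by move=> /(_ w) K; apply: nAw; apply: K; right.
split; first by move=> a [/AE//|->]; exact: (subspaceZ _ cE).
move=> a b [Aa|->] [Ab|->]; first exact: AO.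
- by rewrite hdotC wA// conjc0 Aw0.
- by rewrite wA// eq_sym Aw0.
- by rewrite ww eqxx.
Qed.

(** Distinct orthonormal vectors are at squared distance 2. If each coordinate is coded by a point
    of the dense set within 1/2, vectors with equal codes have both coordinates less than 1 apart,
    hence a squared distance below 2. *)
Lemma countable_orthonormal_set (A : set H) :
  (exists2 D : set V, countable D & dense D) -> orthonormal_set A -> countable A.
Proof.
move=> [D /countable_injP[f finj] Ddense] AO.
have near_D (v : V) : exists d, D d /\ `|v - d| < 2^-1.
  have [||d [dv Dd]] := Ddense (ball v (2^-1 : R)).
  - by exists v; apply: ballxx; rewrite invr_gt0.
  - exact: ball_open.
  - by exists d; split=> //; rewrite -ball_normE in dv.
have /choice[p pP] := near_D.
apply/countable_injP; exists (fun u => choice.pickle (f (p u.1), f (p u.2))).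
move=> u v /set_mem Au /set_mem Av /(pcan_inj (@choice.pickleK _))[].
move=> /finj; rewrite !inE => /(_ (pP _).1 (pP _).1) p1.
move=> /finj; rewrite !inE => /(_ (pP _).1 (pP _).1) p2.
have close (x y : V) : p x = p y -> `|x - y| ^+ 2 < 1.
  move=> pxy; rewrite expr_lt1//; apply: le_lt_trans (ler_distD (p x) _ _) _.
  rewrite [ltRHS]splitr ltrD ?(pP x).2//.
    by rewrite div1r; exact: (pP x).2.
  by rewrite pxy distrC div1r; exact: (pP y).2.
apply/eqP; apply: contraT => uv.
suff : nrm (u - v) ^+ 2 = 2.
  by rewrite hnorm_pair => h; have := ltrD (close _ _ p1) (close _ _ p2); rewrite h ltxx.
rewrite hnormD2 hnormN hdotNr AO// (negPf uv) !hnormE !AO// !eqxx /=; lra.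
Qed.

(** A finite maximal set would span [E] over the complex numbers; the components of its members
    would then span, over the reals, the first components of [E], which fill [V]. *)
Lemma infinite_orthonormal_set (E A : set H) : closed_subspace ip E ->
  (~ exists (n : nat) (e : 'I_n -> V),
     forall v : V, exists c : 'I_n -> R, v = \sum_(i < n) c i *: e i) ->
  (forall v : V, exists2 u, E u & u.1 = v) -> A `<=` E ->
  orthonormal_set A -> (forall u, E u -> (forall a, A a -> dot u a = 0) -> u = 0) ->
  infinite_set A.
Proof.
move=> cE Vinf E1 AE AO Amax /finite_seqP[s0 As0]; apply: Vinf.
have [s sU As] : exists2 s : seq H, uniq s & A = [set` s].
  exists (undup s0); first exact: undup_uniq.
  by rewrite As0; apply/seteqP; split=> x /=; rewrite mem_undup.
have sA (j : 'I_(size s)) : A (s`_j) by rewrite As /=; exact: mem_nth.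
pose e (i : 'I_(size s + size s)) : V :=
  match fintype.split i with inl j => (s`_j : H).1 | inr j => (s`_j : H).2 end.
exists (size s + size s)%N, e => v; have [u Eu <-] := E1 v.
pose a (j : 'I_(size s)) := dot u s`_j.
have uE : u = \sum_(j < size s) a j *: s`_j.
  apply/eqP; rewrite -subr_eq0; apply/eqP; apply: Amax.
    apply: (subspaceB cE) => //.
    elim/big_ind : _ => [|x y Ex Ey|j _]; first exact: (subspace0 cE).
      by rewrite -[x]scale1r; exact: (subspaceP cE).
    exact/(subspaceZ _ cE)/AE.
  move=> b; rewrite As /= => bs.
  have ib : (index b s < size s)%N by rewrite index_mem.
  rewrite hdotBl hdot_suml (bigD1 (Ordinal ib))//= big1 ?addr0; last first.
    have Ab : A b by rewrite As.
    move=> j jb; rewrite hdotZl (AO _ _ (sA j) Ab).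
    rewrite (_ : (_ == _) = false) ?mulr0//; apply/eqP => jE.
    move/eqP: jb; apply; apply: val_inj => /=.
    by rewrite -jE index_uniq.
  have Ab : A b by rewrite As.
  by rewrite hdotZl /a /= nth_index// (AO _ _ Ab Ab) eqxx mulr1 subrr.
(* The first component of [(p + i q) (v1, v2)] is [p v1 - q v2]. *)
exists (fun i => match fintype.split i with inl j => complex.Re (a j)
                                  | inr j => - complex.Im (a j) end).
rewrite big_split_ord /= {1}uE.
rewrite (eq_bigr (fun j => complex.Re (a j) *: (s`_j : H).1)); last first.
  by move=> j _; rewrite /e (unsplitK (inl j)).
rewrite [X in _ = _ + X](eq_bigr (fun j => - complex.Im (a j) *: (s`_j : H).2)); last first.
  by move=> j _; rewrite /e (unsplitK (inr j)).
rewrite -big_split /= (big_morph (fun w : H => w.1) (id1 := 0) (op1 := +%R))//.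
by apply: eq_bigr => j _; rewrite scaleNr.
Qed.

(** The condition on first components treats [H] and both eigenspaces alike, since each of them
    projects onto [V]. *)
Lemma hilbert_basis_exists (E : set H) : closed_subspace ip E ->
  (~ exists (n : nat) (e : 'I_n -> V),
     forall v : V, exists c : 'I_n -> R, v = \sum_(i < n) c i *: e i) ->
  (exists2 D : set V, countable D & dense D) ->
  (forall v : V, exists2 u, E u & u.1 = v) ->
  exists e, hilbert_basis ip E e.
Proof.
move=> cE Vinf Vsep E1; have [A [AE AO Amax]] := maximal_orthonormal_set cE.
have Acount := countable_orthonormal_set Vsep AO.
have Ainf := infinite_orthonormal_set cE Vinf E1 AE AO Amax.
have /card_set_bijP[f [_ finj fsurj]] : (A #= [set: nat])%card.
  by rewrite card_eq_le; apply/andP; split=> //; apply/infiniteP.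
have /choice[e eP] n : exists a, A a /\ f a = n.
  by have [a Aa fa] := fsurj n Logic.I; exists a.
exists e; split.
- by move=> n; apply: AE; exact: (eP n).1.
- move=> m n; rewrite (AO _ _ (eP m).1 (eP n).1); congr (_%:R); congr nat_of_bool.
  apply/eqP/eqP => [emn|->//].
  by rewrite -(eP m).2 -(eP n).2 emn.
- move=> u Eu ue; apply: Amax => // a Aa.
  suff -> : a = e (f a) by [].
  by apply: finj; rewrite ?inE ?(eP _).2//; exact: (eP _).1.
Qed.

End BasisExistence.

(** * Nonnegative series, between the reals and the extended reals *)

Section RealSeries.
Context (R : realType).
Implicit Types (f : nat -> R) (s : R).

Lemma ge0_series_cvg f (K : R) : (forall n, 0 <= f n) ->
  (forall n, \sum_(0 <= k < n) f k <= K) ->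
  exists2 s, (fun n => \sum_(0 <= k < n) f k) @ \oo --> s & s <= K.
Proof.
move=> f0 fK; pose S n := \sum_(0 <= k < n) f k.
have Scvg : cvgn S.
  apply: nondecreasing_is_cvgn; last by exists K => _ [n _ <-]; exact: fK.
  by apply/nondecreasing_seqP => n; rewrite /S big_nat_recr//= lerDl.
by exists (limn S) => //; apply: limr_le => //; near=> n; exact: fK.
Unshelve. all: by end_near.
Qed.

Lemma ge0_series_le f s n : (forall n, 0 <= f n) ->
  (fun n => \sum_(0 <= k < n) f k) @ \oo --> s -> \sum_(0 <= k < n) f k <= s.
Proof.
move=> f0 fs; rewrite -(cvg_lim (@norm_hausdorff _ R^o) fs).
apply: (@nondecreasing_cvgn_le _ (fun n => \sum_(0 <= k < n) f k)).
  by apply/nondecreasing_seqP => m; rewrite big_nat_recr//= lerDl.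
by apply/cvg_ex; exists s.
Qed.

Lemma nneseries_EFin f s : (fun n => \sum_(0 <= k < n) f k) @ \oo --> s ->
  (\sum_(0 <= k <oo) (f k)%:E = s%:E)%E.
Proof.
move=> fs; apply: cvg_lim => //.
under eq_fun do rewrite sumEFin.
by apply: cvg_EFin => //; near=> n.
Unshelve. all: by end_near.
Qed.

Lemma nneseries_lty f : (forall n, 0 <= f n) ->
  (\sum_(0 <= k <oo) (f k)%:E < +oo)%E ->
  (fun n => \sum_(0 <= k < n) f k) @ \oo --> fine (\sum_(0 <= k <oo) (f k)%:E)%E.
Proof.
move=> f0 foo.
have h n : (\sum_(0 <= k < n) (f k)%:E <= \sum_(0 <= k <oo) (f k)%:E)%E.
  by apply: nneseries_lim_ge => k _ _; rewrite lee_fin.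
have fin : (\sum_(0 <= k <oo) (f k)%:E)%E \is a fin_num.
  by rewrite ge0_fin_numE//; apply: nneseries_ge0 => k _ _; rewrite lee_fin.
have [|s fs _] := @ge0_series_cvg f (fine (\sum_(0 <= k <oo) (f k)%:E)%E) f0.
  by move=> n; have := h n; rewrite sumEFin -{1}(fineK fin) lee_fin.
by rewrite (nneseries_EFin fs).
Qed.

End RealSeries.

(** * Hilbert-Schmidt sums and traces of products *)

Section HilbertSchmidt.
Context (R : realType) (V : completeNormedModType R) (ip : {dot V for idfun}).
Context {ip_norm : norm_of_dot ip}.
Local Notation H := (complexification V).
Local Notation dot := (hdot ip).
Local Notation nrm := (hnorm ip).
Implicit Types (u v w : H) (c : R[i]) (e f : nat -> H) (A B S T : H -> H).

(** The squared Hilbert-Schmidt norm, as a relation that includes finiteness and leaves the sequence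
    [e] free, so that sums along different bases can be compared. *)
Definition hsval e T (s : R) : Prop :=
  (fun n => \sum_(0 <= k < n) nrm (T (e k)) ^+ 2) @ \oo --> s.

Definition trcvg e T (z : R[i]) : Prop :=
  ccvg (fun n => \sum_(0 <= k < n) dot (T (e k)) (e k)) z.

Lemma Tr_trcvg T z : trcvg (onb ip setT) T z -> Tr ip T = z.
Proof. exact: ccvg_limn. Qed.

Lemma hsval_partial e T s n : hsval e T s ->
  \sum_(0 <= k < n) nrm (T (e k)) ^+ 2 <= s.
Proof. by apply: ge0_series_le => k; exact: sqr_ge0. Qed.

Lemma hsval_ge0 e T s : hsval e T s -> 0 <= s.
Proof. by move=> /(hsval_partial 0); rewrite big_geq. Qed.

Lemma hsval_ex e T K : (forall n, \sum_(0 <= k < n) nrm (T (e k)) ^+ 2 <= K) ->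
  exists2 s, hsval e T s & s <= K.
Proof. by apply: ge0_series_cvg => k; exact: sqr_ge0. Qed.

Lemma hsval_ext e S T s : (forall n, S (e n) = T (e n)) ->
  hsval e S s -> hsval e T s.
Proof. by move=> ST; rewrite /hsval; under eq_fun do under eq_bigr do rewrite ST. Qed.

Lemma hsval_scale e T c s : hsval e T s ->
  hsval e (fun u => c *: T u) (sqmod c * s).
Proof.
move=> Ts; rewrite /hsval; under eq_fun do under eq_bigr do rewrite hnormZ2.
under eq_fun do rewrite -mulr_sumr.
by apply: cvgM => //; exact: cvg_cst.
Qed.

Lemma hsval_add e S T s t : hsval e S s -> hsval e T t ->
  exists2 r, hsval e (fun u => S u + T u) r & r <= 2 * s + 2 * t.
Proof.
move=> Ss Tt; apply: hsval_ex => n.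
apply: (@le_trans _ _ (\sum_(0 <= k < n) (2 * nrm (S (e k)) ^+ 2 + 2 * nrm (T (e k)) ^+ 2))).
  apply: ler_sum => k _.
  apply: (@le_trans _ _ ((nrm (S (e k)) + nrm (T (e k))) ^+ 2)).
    by rewrite ler_pXn2r ?nnegrE ?addr_ge0 ?hnorm_ge0 ?hnormD.
  by have := sqr_ge0 (nrm (S (e k)) - nrm (T (e k))); lra.
by rewrite big_split /= -!mulr_sumr lerD// ler_pM2l// hsval_partial.
Qed.

Lemma hsval_comp e S T (C : R) t : (forall u, nrm (S u) <= C * nrm u) ->
  hsval e T t -> exists2 r, hsval e (S \o T) r & r <= C ^+ 2 * t.
Proof.
move=> SC Tt; apply: hsval_ex => n.
apply: (@le_trans _ _ (\sum_(0 <= k < n) C ^+ 2 * nrm (T (e k)) ^+ 2)).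
  apply: ler_sum => k _; rewrite -exprMn ler_pXn2r ?nnegrE ?hnorm_ge0//.
    exact: SC.
  exact: le_trans (hnorm_ge0 _ _) (SC _).
by rewrite -mulr_sumr ler_wpM2l ?sqr_ge0// hsval_partial.
Qed.

(** By Parseval both sums are double series of [|<T e_n, f_m>|^2], which may be interchanged because
    the terms are nonnegative. The subspaces are kept general to treat restrictions to [H+] and
    [H-]. *)
Lemma hsval_dual (E F : set H) e f S T s :
  closed_subspace ip E -> closed_subspace ip F ->
  hilbert_basis ip E e -> hilbert_basis ip F f ->
  (forall n, F (T (e n))) -> (forall m, E (S (f m))) ->
  (forall m n, dot (T (e n)) (f m) = dot (e n) (S (f m))) ->
  hsval e T s -> hsval f S s.
Proof.
move=> cE cF eB fB TF SE TS Ts.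
have eT : (\sum_(0 <= n <oo) (nrm (T (e n)) ^+ 2)%:E =
           \sum_(0 <= m <oo) (nrm (S (f m)) ^+ 2)%:E)%E.
  rewrite (eq_eseriesr (g := fun n => \sum_(0 <= m <oo)
    (sqmod (dot (T (e n)) (f m)))%:E)%E); last first.
    by move=> n _; rewrite (nneseries_EFin (parseval cF fB (TF n))).
  rewrite nneseries_interchange; last by move=> *; rewrite lee_fin sqmod_ge0.
  apply: eq_eseriesr => m _; rewrite -(nneseries_EFin (parseval cE eB (SE m))).
  by apply: eq_eseriesr => n _; rewrite TS hdotC sqmod_conj.
have := nneseries_EFin Ts; rewrite eT => Ss.
have := @nneseries_lty _ (fun m => nrm (S (f m)) ^+ 2).
by rewrite Ss /=; apply => // [m|]; rewrite ?sqr_ge0 ?ltry.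
Qed.

(** Carrying an explicit adjoint lets adjoints of sums and products be computed; [adjointE] links it
    to the chosen [adjoint]. *)
Definition adjoint_pair A B : Prop :=
  [/\ bounded_op ip setT setT A, bounded_op ip setT setT B
    & forall u v, dot (A u) v = dot u (B v)].

Lemma adjoint_pairC A B : adjoint_pair A B -> adjoint_pair B A.
Proof. by move=> [bA bB AB]; split=> // u v; rewrite hdotC -AB -hdotC. Qed.

Lemma adjoint_pair_unique A B B' : adjoint_pair A B -> adjoint_pair A B' -> B = B'.
Proof.
move=> [_ _ AB] [_ _ AB']; apply/funext => v.
by apply: (hdot_separates (ip := ip)) => w; rewrite -AB AB'.
Qed.

Lemma adjointE A B : adjoint_pair A B -> adjoint ip A = B.
Proof.
move=> AB; have [bA bB h] := AB; rewrite /adjoint.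
apply: xget_unique => [|B' [bB' h']]; first by split.
by apply: (adjoint_pair_unique _ AB); split.
Qed.

Lemma bounded_op_id : bounded_op ip setT setT idfun.
Proof. by split=> //; exists 1 => u _; rewrite mul1r. Qed.

Lemma bounded_opD S T : bounded_op ip setT setT S -> bounded_op ip setT setT T ->
  bounded_op ip setT setT (fun u => S u + T u).
Proof.
move=> bS bT; have [_ Sl _] := bS; have [_ Tl _] := bT.
have [C C0 SC] := bounded_op_ge0 bS; have [D D0 TD] := bounded_op_ge0 bT.
split=> // [c u v _ _|]; first by rewrite Sl// Tl// scalerDr addrACA.
exists (C + D) => u _; apply: le_trans (hnormD _ _) _.
by rewrite mulrDl lerD ?SC ?TD.
Qed.

Lemma bounded_opZ c T : bounded_op ip setT setT T ->
  bounded_op ip setT setT (fun u => c *: T u).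
Proof.
move=> bT; have [_ Tl _] := bT; have [C C0 TC] := bounded_op_ge0 bT.
split=> // [a u v _ _|]; first by rewrite Tl// scalerDr !scalerA mulrC.
exists (Num.sqrt (sqmod c) * C) => u _; rewrite hnormZ -mulrA.
by rewrite ler_wpM2l ?sqrtr_ge0 ?TC.
Qed.

Lemma bounded_op_comp S T : bounded_op ip setT setT S ->
  bounded_op ip setT setT T -> bounded_op ip setT setT (S \o T).
Proof.
move=> bS bT; have [_ Sl _] := bS; have [_ Tl _] := bT.
have [C C0 SC] := bounded_op_ge0 bS; have [D D0 TD] := bounded_op_ge0 bT.
split=> // [c u v _ _|]; first by rewrite /= Tl// Sl.
exists (C * D) => u _ /=; apply: le_trans (SC _ _) _ => //.
by rewrite -mulrA ler_wpM2l// TD.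
Qed.

Lemma adjoint_pair_id : adjoint_pair idfun idfun.
Proof. by split=> //; exact: bounded_op_id. Qed.

Lemma adjoint_pairD A A' B B' : adjoint_pair A A' -> adjoint_pair B B' ->
  adjoint_pair (fun u => A u + B u) (fun u => A' u + B' u).
Proof.
move=> [bA bA' AA'] [bB bB' BB']; split; [exact: bounded_opD..|].
by move=> u v; rewrite hdotDl hdotDr AA' BB'.
Qed.

Lemma adjoint_pairZ c A A' : adjoint_pair A A' ->
  adjoint_pair (fun u => c *: A u) (fun u => conjc c *: A' u).
Proof.
move=> [bA bA' AA']; split; [exact: bounded_opZ..|].
by move=> u v; rewrite hdotZl hdotZr conjcK AA'.
Qed.

Lemma adjoint_pair_comp A A' B B' : adjoint_pair A A' -> adjoint_pair B B' ->
  adjoint_pair (A \o B) (B' \o A').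
Proof.
move=> [bA bA' AA'] [bB bB' BB']; split; [exact: bounded_op_comp..|].
by move=> u v; rewrite /= AA' BB'.
Qed.

Lemma hsval_adjoint e f A A' s : hilbert_basis ip setT e ->
  hilbert_basis ip setT f -> adjoint_pair A A' -> hsval e A s -> hsval f A' s.
Proof.
move=> eB fB [_ _ AA'].
by apply: (hsval_dual (@closed_subspaceT _ _ ip) (@closed_subspaceT _ _ ip) eB fB).
Qed.

Lemma hsval_basis e f A A' s : hilbert_basis ip setT e ->
  hilbert_basis ip setT f -> adjoint_pair A A' -> hsval e A s -> hsval f A s.
Proof.
move=> eB fB AA' /(hsval_adjoint eB eB AA').
exact: hsval_adjoint (adjoint_pairC AA').
Qed.

(* The Hilbert-Schmidt inner product of [A] and [B], by polarization. *)
Definition hsdot e A B (z : R[i]) : Prop := exists a b p q : R,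
  [/\ hsval e A a, hsval e B b, hsval e (fun u => A u + B u) p,
      hsval e (fun u => A u + 'i%C *: B u) q
    & z = ((p - a - b) / 2) +i* ((q - a - b) / 2)].

Lemma hsdot_ex e A B a b : hsval e A a -> hsval e B b -> exists z, hsdot e A B z.
Proof.
move=> Aa Bb; have [p Ap _] := hsval_add Aa Bb.
have [q Aq _] := hsval_add Aa (hsval_scale (c := 'i%C) Bb).
by exists (((p - a - b) / 2) +i* ((q - a - b) / 2)), a, b, p, q.
Qed.

Lemma hsdot_cvg e A B z : hsdot e A B z ->
  ccvg (fun n => \sum_(0 <= k < n) dot (A (e k)) (B (e k))) z.
Proof.
move=> [a [b [p [q [Aa Bb ABp ABq ->]]]]].
(* Polarization. As the product is antilinear on the right, [<u, i v> = - i <u, v>] has real part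
   [Im <u, v>]. *)
have dE u v : dot u v = ((nrm (u + v) ^+ 2 - nrm u ^+ 2 - nrm v ^+ 2) / 2) +i*
    ((nrm (u + 'i%C *: v) ^+ 2 - nrm u ^+ 2 - nrm v ^+ 2) / 2).
  rewrite !hnormD2 hnormZ2 hdotZr.
  have -> : sqmod ('i%C : R[i]) = 1 by rewrite /sqmod /= expr0n expr1n add0r.
  by case: (dot u v) => x y; rewrite /=; congr (_ +i* _); field.
have sE n : \sum_(0 <= k < n) dot (A (e k)) (B (e k)) =
  ((\sum_(0 <= k < n) nrm (A (e k) + B (e k)) ^+ 2 -
    \sum_(0 <= k < n) nrm (A (e k)) ^+ 2 -
    \sum_(0 <= k < n) nrm (B (e k)) ^+ 2) / 2) +i*
  ((\sum_(0 <= k < n) nrm (A (e k) + 'i%C *: B (e k)) ^+ 2 -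
    \sum_(0 <= k < n) nrm (A (e k)) ^+ 2 -
    \sum_(0 <= k < n) nrm (B (e k)) ^+ 2) / 2).
  elim: n => [|n IH]; first by rewrite !big_geq// subrr sub0r oppr0 mul0r.
  rewrite !big_nat_recr//= IH dE; simpc; congr (_ +i* _); ring.
by split=> /=; under eq_fun do rewrite sE /=; apply: cvgM; try exact: cvg_cst;
  apply: (@cvgB _ R^o) => //; exact: (@cvgB _ R^o).
Qed.

Lemma hsdot_le e A B z a b : hsval e A a -> hsval e B b -> hsdot e A B z ->
  sqmod z <= a * b.
Proof.
move=> Aa Bb /hsdot_cvg[z1 z2].
have cv : (fun n => sqmod (\sum_(0 <= k < n) dot (A (e k)) (B (e k)))) @ \oo --> sqmod z.
  by apply: (@cvgD _ R^o); under eq_fun do rewrite expr2; rewrite expr2; exact: cvgM.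
apply: (cvgr_to_le cv); near=> n.
apply: (@le_trans _ _ ((\sum_(0 <= k < n) nrm (B (e k)) ^+ 2) *
                       (\sum_(0 <= k < n) nrm (A (e k)) ^+ 2))); last first.
  rewrite mulrC; apply: ler_pM; rewrite ?hsval_partial//;
  by apply: sumr_ge0 => k _; exact: sqr_ge0.
apply: quadratic_form_discr => [|c].
  by apply: sumr_ge0 => k _; exact: sqr_ge0.
have -> : complex.Re (c * \sum_(0 <= k < n) dot (A (e k)) (B (e k))) =
    \sum_(0 <= k < n) complex.Re (c * dot (A (e k)) (B (e k))).
  rewrite mulr_sumr; apply: (big_morph (@complex.Re R)) => //.
  by case=> x1 y1 [].
rewrite !mulr_sumr -!big_split /=; apply: sumr_ge0 => k _.
have := sqr_ge0 (nrm (B (e k) + c *: A (e k))); rewrite hnormD2 hnormZ2.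
by rewrite hdotZr (hdotC ip (A (e k))) -conjcM Re_conjc.
Unshelve. all: by end_near.
Qed.

(** Each of the four sums of squares behind the value survives the passage to adjoints, and this
    passage also changes the basis. *)
Lemma hsdot_adjoint e f A A' B B' z : hilbert_basis ip setT e ->
  hilbert_basis ip setT f -> adjoint_pair A A' -> adjoint_pair B B' ->
  hsdot e A B z -> hsdot f B' A' z.
Proof.
move=> eB fB AA' BB' [a [b [p [q [Aa Bb ABp ABq ->]]]]].
exists b, a, p, q; split.
- exact: hsval_adjoint BB' Bb.
- exact: hsval_adjoint AA' Aa.
- have := hsval_adjoint eB fB (adjoint_pairD AA' BB') ABp.
  by apply: hsval_ext => n; rewrite addrC.
(* The adjoint of [A + i B] is [A' - i B']; multiplied by [i], which preserves norms, it becomes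
   [B' + i A']. *)
- have /(hsval_scale (c := 'i%C)) :=
    hsval_adjoint eB fB (adjoint_pairD AA' (adjoint_pairZ 'i%C BB')) ABq.
  rewrite (_ : sqmod _ * q = q); last first.
    by rewrite /sqmod /= expr0n expr1n add0r mul1r.
  apply: hsval_ext => n; rewrite scalerDr scalerA addrC; congr (_ + _).
  by rewrite (_ : _ * _ = 1) ?scale1r//; simpc.
- by congr (_ +i* _); rewrite addrAC.
Qed.

(* Cyclicity of the trace and its independence of the basis in one stroke. *)
Lemma trcvg_comp e f S S' T T' s t : hilbert_basis ip setT e ->
  hilbert_basis ip setT f -> adjoint_pair S S' -> adjoint_pair T T' ->
  hsval e S s -> hsval e T t ->
  exists z, [/\ trcvg e (S \o T) z, trcvg f (T \o S) z & sqmod z <= s * t].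
Proof.
move=> eB fB SS' TT' Ss Tt.
have S's := hsval_adjoint eB eB SS' Ss.
have [z TSz] := hsdot_ex Tt S's.
exists z; split.
- have := hsdot_cvg TSz; rewrite /trcvg.
  have [_ _ h] := SS'; under eq_fun do under eq_bigr do rewrite -h.
  by [].
- have := hsdot_cvg (hsdot_adjoint eB fB TT' (adjoint_pairC SS') TSz); rewrite /trcvg.
  have [_ _ h] := TT'; under eq_fun do under eq_bigr do rewrite -h.
  by [].
- by rewrite mulrC; exact: hsdot_le TSz.
Qed.

Lemma trcvgD e S T x y : trcvg e S x -> trcvg e T y ->
  trcvg e (fun u => S u + T u) (x + y).
Proof.
move=> Sx Ty; rewrite /trcvg.
under eq_fun do [under eq_bigr do rewrite hdotDl; rewrite big_split].
exact: ccvgD.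
Qed.

Lemma trcvgZ e c T x : trcvg e T x -> trcvg e (fun u => c *: T u) (c * x).
Proof.
move=> Tx; rewrite /trcvg.
under eq_fun do [under eq_bigr do rewrite hdotZl; rewrite -mulr_sumr].
exact: ccvgZ.
Qed.

End HilbertSchmidt.

Class orthogonal_complex_structure (R : realType) (V : normedModType R)
    (ip : {dot V for idfun}) (J : {linear V -> V}) : Prop :=
  OrthogonalComplexStructure {
    complex_structure_sqr : forall v : V, J (J v) = - v;
    complex_structure_isometry : forall u v : V, ip (J u) (J v) = ip u v }.

(** * The eigenspaces of [J], their projections and conjugation *)

Section Polarization.
Context (R : realType) (V : completeNormedModType R) (ip : {dot V for idfun}).
Context {ip_norm : norm_of_dot ip}.
Context (J : {linear V -> V}) {J_ocs : orthogonal_complex_structure ip J}.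
Local Notation H := (complexification V).
Local Notation dot := (hdot ip).
Local Notation nrm := (hnorm ip).
Local Notation JC := (@JC R V J).
Local Notation Hp := (@Hplus R V J).
Local Notation Hm := (@Hminus R V J).
Local Notation pp := (@proj_plus R V J).
Implicit Types (u v w : H) (c : R[i]).

Definition proj_minus u : H := 2^-1 *: (u + 'i%C *: JC u).
Local Notation pm := proj_minus.

Lemma JC_linear c u v : JC (c *: u + v) = c *: JC u + JC v.
Proof.
case: c u v => a b [u1 u2] [v1 v2]; rewrite /Defs.JC /=.
by congr pair; rewrite /= linearD ?linearB ?linearD !linearZ.
Qed.

Lemma JC_D u v : JC (u + v) = JC u + JC v.
Proof. by have := JC_linear 1 u v; rewrite !scale1r. Qed.

Lemma JC_Z c u : JC (c *: u) = c *: JC u.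
Proof.
have JC0 : JC 0 = 0 by rewrite /Defs.JC /= linear0.
by have := JC_linear c u 0; rewrite JC0 !addr0.
Qed.

Lemma JC_JC u : JC (JC u) = - u.
Proof. by case: u => a b; rewrite /Defs.JC /= !complex_structure_sqr. Qed.

Lemma hdot_JC_JC u v : dot (JC u) (JC v) = dot u v.
Proof. by rewrite /hdot /= !complex_structure_isometry. Qed.

Lemma hdot_JC u v : dot (JC u) v = dot u (- JC v).
Proof. by rewrite -hdot_JC_JC JC_JC hdotNl hdotNr. Qed.

Lemma hnorm_JC u : nrm (JC u) = nrm u.
Proof. by rewrite /hnorm hdot_JC_JC. Qed.

Lemma hconj_JC u : hconj (JC u) = JC (hconj u).
Proof. by case: u => a b; rewrite /hconj /Defs.JC /= linearN. Qed.

Lemma hconjK u : hconj (hconj u) = u.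
Proof. by case: u => a b; rewrite /hconj /= opprK. Qed.

Lemma hconjD u v : hconj (u + v) = hconj u + hconj v.
Proof. by case: u v => a b [c d]; rewrite /hconj /= opprD. Qed.

Lemma hconjN u : hconj (- u) = - hconj u.
Proof. by case: u => a b; rewrite /hconj. Qed.

Lemma hconjZ c u : hconj (c *: u) = conjc c *: hconj u.
Proof.
case: c u => a b [u1 u2]; rewrite /hconj.
by congr pair => /=; rewrite ?scalerN ?scaleNr ?opprK ?opprD// addrC.
Qed.

Lemma hnorm_hconj u : nrm (hconj u) = nrm u.
Proof. by rewrite /hnorm hdot_hconj Re_conjc. Qed.

Lemma bounded_op_JC : bounded_op ip setT setT JC.
Proof.
split=> // [c u v _ _|]; first exact: JC_linear.
by exists 1 => u _; rewrite hnorm_JC mul1r.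
Qed.

Lemma bounded_op_barop T : bounded_op ip setT setT T ->
  bounded_op ip setT setT (barop T).
Proof.
move=> [_ Tl [C TC]]; split=> // [c u v _ _|].
  by rewrite /barop hconjD hconjZ Tl// hconjD hconjZ conjcK.
by exists C => u _; rewrite /barop hnorm_hconj -(hnorm_hconj u) TC.
Qed.

Lemma adjoint_pair_barop A B : adjoint_pair ip A B ->
  adjoint_pair ip (barop A) (barop B).
Proof.
move=> [bA bB AB]; split; [exact: bounded_op_barop..|].
by move=> u v; rewrite /barop -{1}(hconjK v) hdot_hconj AB -hdot_hconj hconjK.
Qed.

Lemma adjoint_pair_JC : adjoint_pair ip JC (fun u => - JC u).
Proof.
split; [exact: bounded_op_JC| |exact: hdot_JC].
rewrite (_ : (fun u => _) = fun u => -1 *: JC u).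
  exact: bounded_opZ bounded_op_JC.
by apply/funext => u; rewrite scaleN1r.
Qed.

Let ii : 'i%C * 'i%C = -1 :> R[i].
Proof. by simpc. Qed.

Let half_double u : 2^-1 *: (u + u) = u.
Proof.
have -> : u + u = (2 : R[i]) *: u by rewrite scaler_nat mulr2n.
by rewrite scalerA mulVf ?scale1r// pnatr_eq0.
Qed.

Lemma proj_plusE u : Hp (pp u).
Proof.
rewrite /Hplus /= /proj_plus JC_Z scalerA [_ * 2^-1]mulrC -scalerA; congr (_ *: _).
rewrite -scaleNr JC_D JC_Z JC_JC scalerDr scalerA mulrN ii opprK scale1r addrC.
by rewrite scalerN scaleNr opprK.
Qed.

Lemma proj_minusE u : Hm (pm u).
Proof.
rewrite /Hminus /= /proj_minus JC_Z scalerA [_ * 2^-1]mulrC -scalerA; congr (_ *: _).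
rewrite JC_D JC_Z JC_JC scalerDr scalerA mulNr ii opprK scale1r addrC.
by rewrite scalerN scaleNr.
Qed.

Lemma proj_decomp u : pp u + pm u = u.
Proof.
by rewrite /proj_plus /proj_minus -scalerDr addrACA addNr addr0 half_double.
Qed.

Lemma proj_plus_id u : Hp u -> pp u = u.
Proof.
rewrite /Hplus /= /proj_plus => ->.
by rewrite [_ *: (_ *: u)]scalerA ii scaleN1r opprK half_double.
Qed.

Lemma proj_minus_id u : Hm u -> pm u = u.
Proof.
rewrite /Hminus /= /proj_minus => ->.
by rewrite [_ *: (_ *: u)]scalerA mulrN ii opprK scale1r half_double.
Qed.

Lemma proj_minus0 u : Hp u -> pm u = 0.
Proof.
by move=> /proj_plus_id Hu; apply: (@addrI _ (pp u)); rewrite proj_decomp addr0.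
Qed.

Lemma proj_plus0 u : Hm u -> pp u = 0.
Proof.
by move=> /proj_minus_id Hu; apply: (@addIr _ (pm u)); rewrite proj_decomp add0r.
Qed.

Let half_linear (k : R[i]) c u v :
  2^-1 *: (c *: u + v + k *: JC (c *: u + v)) =
  c *: (2^-1 *: (u + k *: JC u)) + 2^-1 *: (v + k *: JC v).
Proof.
rewrite JC_linear [k *: (_ + _)]scalerDr addrACA scalerDr; congr (_ + _).
rewrite [RHS]scalerA [c * _]mulrC -scalerA; congr (_ *: _).
by rewrite scalerDr !scalerA mulrC.
Qed.

Lemma proj_plus_linear c u v : pp (c *: u + v) = c *: pp u + pp v.
Proof. by rewrite /proj_plus -!scaleNr half_linear. Qed.

Lemma proj_minus_linear c u v : pm (c *: u + v) = c *: pm u + pm v.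
Proof. exact: half_linear. Qed.

Lemma hconj_plus u : Hp u -> Hm (hconj u).
Proof.
rewrite /Hplus /Hminus /= -hconj_JC => ->; rewrite hconjZ.
by congr (_ *: _); simpc.
Qed.

Lemma hconj_minus u : Hm u -> Hp (hconj u).
Proof.
rewrite /Hplus /Hminus /= -hconj_JC => ->; rewrite hconjZ.
by congr (_ *: _); simpc.
Qed.

Lemma hconj_proj_minus u : hconj (pm u) = pp (hconj u).
Proof.
rewrite -{2}(proj_decomp u) hconjD -[hconj (pp u)]scale1r proj_plus_linear.
rewrite (proj_plus0 (hconj_plus (proj_plusE u))) scaler0 add0r proj_plus_id//.
exact: hconj_minus (proj_minusE _).
Qed.

Lemma hconj_proj_plus u : hconj (pp u) = pm (hconj u).
Proof. by rewrite -{1}(hconjK u) -hconj_proj_minus hconjK. Qed.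

(** [J] is unitary and [i conj (- i) = -1], so the product equals its own opposite. *)
Lemma hdot_plus_minus u v : Hp u -> Hm v -> dot u v = 0.
Proof.
move=> Hu Hv; have := hdot_JC_JC u v; rewrite Hu Hv hdotZl hdotZr mulrA.
rewrite (_ : 'i%C * conjc (- 'i%C) = -1); last by apply: complex_ext => /=; ring.
by rewrite mulN1r => h; case: (dot u v) h => a b [h1 h2]; congr (_ +i* _); lra.
Qed.

Lemma hcvg_JC (u : nat -> H) l : hcvg ip u l -> hcvg ip (fun n => JC (u n)) (JC l).
Proof.
rewrite /hcvg; under [X in _ -> X @ _ --> _]eq_fun do
  rewrite -[- _]scaleN1r -JC_Z -JC_D scaleN1r hnorm_JC.
by [].
Qed.

Lemma closed_subspace_eigen c : closed_subspace ip [set u : H | JC u = c *: u].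
Proof.
split=> [|a u v /= Hu Hv|u l Hu ul] /=.
- by rewrite scaler0 /Defs.JC /= linear0.
- by rewrite JC_linear Hu Hv scalerDr !scalerA mulrC.
- apply: (hcvg_unique (hcvg_JC ul)).
  by rewrite (_ : (fun n => _) = fun n => c *: u n); [exact: hcvgZ|apply/funext].
Qed.

Lemma closed_Hplus : closed_subspace ip Hp.
Proof. exact: closed_subspace_eigen. Qed.

Lemma closed_Hminus : closed_subspace ip Hm.
Proof. exact: closed_subspace_eigen. Qed.

Lemma bounded_op_proj_plus : bounded_op ip setT setT pp.
Proof.
apply: bounded_opZ.
rewrite (_ : (fun u => _) = fun u => u + (- 'i%C) *: JC u).
  exact: bounded_opD (bounded_op_id ip) (bounded_opZ _ bounded_op_JC).
by apply/funext => u; rewrite scaleNr.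
Qed.

Lemma bounded_op_proj_minus : bounded_op ip setT setT pm.
Proof.
apply: bounded_opZ.
exact: bounded_opD (bounded_op_id ip) (bounded_opZ _ bounded_op_JC).
Qed.

Lemma hdot_proj_plus u v : dot (pp u) v = dot (pp u) (pp v).
Proof.
by rewrite -{1}(proj_decomp v) hdotDr (hdot_plus_minus (proj_plusE u) (proj_minusE v)) addr0.
Qed.

Lemma hdot_proj_minus u v : dot (pm u) v = dot (pm u) (pm v).
Proof.
rewrite -{1}(proj_decomp v) hdotDr (hdotC ip (pp v)).
by rewrite (hdot_plus_minus (proj_plusE v) (proj_minusE u)) conjc0 add0r.
Qed.

Lemma adjoint_pair_proj_plus : adjoint_pair ip pp pp.
Proof.
split; [exact: bounded_op_proj_plus..|] => u v.
by rewrite hdot_proj_plus [in RHS]hdotC [in RHS]hdot_proj_plus -hdotC.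
Qed.

Lemma adjoint_pair_proj_minus : adjoint_pair ip pm pm.
Proof.
split; [exact: bounded_op_proj_minus..|] => u v.
by rewrite hdot_proj_minus [in RHS]hdotC [in RHS]hdot_proj_minus -hdotC.
Qed.

(** The witness [v - i J v] is twice the projection of [v] on [H+]. This surjectivity transfers
    infinite dimension from [V] to the eigenspaces. *)
Lemma Hplus_fst (v : V) : exists2 u, Hp u & u.1 = v.
Proof.
exists (v, - J v) => //; rewrite /Hplus /= /Defs.JC /= linearN complex_structure_sqr opprK.
by congr pair => /=; rewrite ?scale0r ?scale1r ?sub0r ?add0r ?opprK.
Qed.

Lemma Hminus_fst (v : V) : exists2 u, Hm u & u.1 = v.
Proof.
by have [u Hu <-] := Hplus_fst v; exists (hconj u) => //; exact: hconj_plus.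
Qed.

End Polarization.

(** [onb] would be the zero sequence if no Hilbert basis existed; these three facts state that the
    chosen sequences are genuine bases. *)
Class polarized_bases (R : realType) (V : completeNormedModType R)
    (ip : {dot V for idfun}) (J : {linear V -> V}) : Prop := PolarizedBases {
  onb_setT : hilbert_basis ip setT (onb ip setT);
  onb_Hplus : hilbert_basis ip (Hplus J) (onb ip (Hplus J));
  onb_Hminus : hilbert_basis ip (Hminus J) (onb ip (Hminus J)) }.

(** * Operators of gl12 are Hilbert-Schmidt *)

Section RestrictedOperators.
Context (R : realType) (V : completeNormedModType R) (ip : {dot V for idfun}).
Context {ip_norm : norm_of_dot ip}.
Context (J : {linear V -> V}) {J_ocs : orthogonal_complex_structure ip J}.
Context {bases : polarized_bases ip J}.
Local Notation H := (complexification V).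
Local Notation dot := (hdot ip).
Local Notation nrm := (hnorm ip).
Local Notation JC := (@JC R V J).
Local Notation Hp := (@Hplus R V J).
Local Notation Hm := (@Hminus R V J).
Local Notation pp := (@proj_plus R V J).
Local Notation pm := (@proj_minus R V J).
Local Notation ebasis := (onb ip setT).
Local Notation fbasis := (onb ip Hp).
Local Notation gbasis := (onb ip Hm).
Implicit Types (u v w : H) (c : R[i]).

(** The choice depends only on the set of candidates, and this set sees only the values on [E]. *)
Lemma absop_ext (E : set H) (S T : H -> H) : (forall u, E u -> S u = T u) ->
  absop ip E S = absop ip E T.
Proof.
move=> ST; rewrite /absop; congr xget; apply/funext => P; apply/propext.
by split=> -[bP P0 PP]; split=> // u v Eu Ev; rewrite PP// !ST.
Qed.

Lemma absopP (E F : set H) (e : nat -> H) T : closed_subspace ip E ->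
  hilbert_basis ip E e -> bounded_op ip E F T -> is_absop ip E T (absop ip E T).
Proof.
by move=> cE eB /(absop_exists cE eB) Pex; exact: (xgetPex (fun=> 0) Pex).
Qed.

(* [|T f_n|^2 = \sum_m |<P f_n, f_m>|^2] with [P = |T|], and Cauchy-Schwarz for
   the form [<P ., .>] bounds each term by a product of diagonal terms. *)
Lemma hsval_trace_norm (E F : set H) T : closed_subspace ip E ->
  hilbert_basis ip E (onb ip E) -> bounded_op ip E F T ->
  (trace_norm ip E T < +oo)%E ->
  exists2 s, hsval ip (onb ip E) T s & s <= fine (trace_norm ip E T) ^+ 2.
Proof.
move=> cE fB bT; have := absopP cE fB bT; rewrite /trace_norm.
set P := absop ip E T; set f := onb ip E => -[[PE Pl _] P0 PP].
have fE n : E (f n) by case: fB.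
pose q n := complex.Re (dot (P (f n)) (f n)).
have q0 n : 0 <= q n by have := P0 _ (fE n); rewrite lecE => /andP[].
move=> /(nneseries_lty q0); set t := fine _ => qt.
have qle n : \sum_(0 <= k < n) q k <= t by exact: ge0_series_le q0 qt.
apply: hsval_ex => n.
have t0 : 0 <= t by have := qle 0%N; rewrite big_geq.
apply: (@le_trans _ _ (\sum_(0 <= k < n) q k * t)); last first.
  by rewrite -mulr_suml expr2 ler_wpM2r.
apply: ler_sum => k _.
have -> : nrm (T (f k)) ^+ 2 = nrm (P (f k)) ^+ 2.
  rewrite !hnormE -PP// (positive_hermitian cE Pl P0 (fE k) (PE _ (fE k))).
  by rewrite Re_conjc.
apply: (cvgr_to_le (parseval cE fB (PE _ (fE k)))); near=> m.
apply: (@le_trans _ _ (\sum_(0 <= j < m) q k * q j)).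
  by apply: ler_sum => j _; exact: (positive_CS cE Pl P0).
by rewrite -mulr_sumr ler_wpM2l.
Unshelve. all: by end_near.
Qed.

Lemma adjoint_pair_ex T : bounded_op ip setT setT T ->
  exists T', adjoint_pair ip T T'.
Proof.
move=> bT; have [T' bT' TT'] := adjoint_on (@closed_subspaceT _ _ ip) (onb_setT (J := J)) bT.
by exists T'; split=> // u v; exact: TT'.
Qed.

(** Two passages to the adjoint: the sum for [T] along a basis of [E] is that of [p T'] along the
    basis of [H], which in turn is that of [T p]. *)
Lemma hsval_comp_proj (E : set H) (p : H -> H) (f : nat -> H) T s :
  closed_subspace ip E -> hilbert_basis ip E f -> bounded_op ip setT setT T ->
  adjoint_pair ip p p -> (forall u, E (p u)) -> (forall u, E u -> p u = u) ->
  hsval ip f T s -> hsval ip ebasis (T \o p) s.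
Proof.
move=> cE fB bT ppp pE pid Ts; have [T' TT'] := adjoint_pair_ex bT.
have eB : hilbert_basis ip setT ebasis by exact: onb_setT.
apply: (hsval_adjoint eB eB (adjoint_pair_comp ppp (adjoint_pairC TT'))).
apply: (hsval_dual cE (@closed_subspaceT _ _ ip) fB eB) Ts => //.
  by move=> m; exact: pE.
move=> m n; have [_ _ h1] := TT'; have [_ _ h2] := ppp.
by rewrite h1 /= -h2 pid//; case: fB.
Qed.

Lemma hilbert_basis_hconj (e : nat -> H) : hilbert_basis ip setT e ->
  hilbert_basis ip setT (fun n => hconj (e n)).
Proof.
move=> [_ e_on e0]; split=> // [m n|u _ ue].
  by rewrite hdot_hconj e_on conjc_nat.
rewrite -(hconjK u) (e0 (hconj u))// => [|n].
  by rewrite /hconj /= oppr0.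
by rewrite -(hconjK (e n)) hdot_hconj ue conjc0.
Qed.

Section Gl12.
Context (A : H -> H) (gA : gl12 ip J A).

(** The blocks are constrained on their eigenspaces only; composed with the projections they give an
    operator on all of [H]. The identity [T = pp \o A] makes the two finite sums those that enter
    [gl12_norm]. *)
Lemma gl12_plus_part : exists T, [/\ bounded_op ip setT setT T, T = pp \o A,
  forall u, A u = T u + barop T u,
  (trace_norm ip Hp T < +oo)%E & (hs_sqnorm ip Hm T < +oo)%E].
Proof.
have [A1 [A2 [[bA1 tA1] [bA2 tA2] AE]]] := gA.
have [A1E A1l _] := bA1; have [A2E A2l _] := bA2.
have [C C0 A1C] := bounded_op_ge0 bA1; have [D D0 A2D] := bounded_op_ge0 bA2.
pose T u := A1 (pp u) + A2 (pm u).
have A10 : A1 0 = 0 := linear_on0 (subspace0 (closed_Hplus (ip := ip) (J := J))) A1l.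
have A20 : A2 0 = 0 := linear_on0 (subspace0 (closed_Hminus (ip := ip) (J := J))) A2l.
have TE u : Hp (T u).
  rewrite /T -[A1 _]scale1r; apply: (subspaceP (closed_Hplus (ip := ip) (J := J))).
    exact: A1E (proj_plusE _).
  exact: A2E (proj_minusE _).
have AT u : A u = T u + barop T u.
  rewrite -{1}(proj_decomp J u) (AE _ _ (proj_plusE _) (proj_minusE _)).
  rewrite /T /barop hconjD -hconj_proj_plus -hconj_proj_minus.
  by congr (_ + _); rewrite addrC.
have ppA : T = pp \o A.
  apply/funext => u; rewrite /= AT -[T u]scale1r (proj_plus_linear J) scale1r.
  rewrite (proj_plus_id (TE u)) (proj_plus0 (hconj_plus (TE _))) addr0.
  by rewrite scale1r.
have TA1 u : Hp u -> T u = A1 u.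
  by move=> Hu; rewrite /T proj_minus0// A20 addr0 proj_plus_id.
have TA2 u : Hm u -> T u = A2 u.
  by move=> Hu; rewrite /T proj_plus0// A10 add0r proj_minus_id.
exists T; split=> //.
- split=> // [c u v _ _|].
    rewrite /T proj_plus_linear proj_minus_linear.
    rewrite A1l ?A2l; try exact: proj_plusE; try exact: proj_minusE.
    by rewrite scalerDr addrACA.
  have [K1 K10 pK1] := bounded_op_ge0 (bounded_op_proj_plus (ip := ip) (J := J)).
  have [K2 K20 pK2] := bounded_op_ge0 (bounded_op_proj_minus (ip := ip) (J := J)).
  exists (C * K1 + D * K2) => u _; apply: le_trans (hnormD _ _) _.
  rewrite mulrDl -!mulrA lerD//.
    by apply: le_trans (A1C _ (proj_plusE _)) _; rewrite ler_wpM2l ?pK1.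
  by apply: le_trans (A2D _ (proj_minusE _)) _; rewrite ler_wpM2l ?pK2.
- rewrite /trace_norm (absop_ext TA1); exact: tA1.
- move: tA2; rewrite /hs_sqnorm; congr (_ < _)%E; apply: eq_eseriesr => n _.
  have [gE _ _] : hilbert_basis ip Hm gbasis by exact: onb_Hminus.
  by rewrite TA2//; exact: gE.
Qed.

Lemma gl12_barop : barop A = A.
Proof.
have [T [bT _ AT _ _]] := gl12_plus_part.
apply/funext => u; rewrite /barop !AT /barop hconjD !hconjK addrC.
by [].
Qed.

Lemma gl12_bounded : bounded_op ip setT setT A.
Proof.
have [T [bT _ AT _ _]] := gl12_plus_part.
rewrite (_ : A = fun u => T u + barop T u); last exact/funext.
exact: bounded_opD bT (bounded_op_barop bT).
Qed.

(** Let [x] be the trace norm of the diagonal block and [y] the Hilbert-Schmidt norm of the other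
    one. Each of the two additions, [T p+ + T p-] and [T + barop T], costs a factor 2: the sum for
    [T] is at most [2 x^2 + 2 y^2], that for [A] at most 4 times as much, and
    [8 (x^2 + y^2) <= 8 (x + y)^2]. *)
Lemma gl12_hsval : 0 <= gl12_norm ip J A /\
  exists2 s, hsval ip ebasis A s & s <= 8 * gl12_norm ip J A ^+ 2.
Proof.
have [T [bT TA AT tT hT]] := gl12_plus_part.
have eB : hilbert_basis ip setT ebasis by exact: onb_setT.
have bTp : bounded_op ip Hp Hp T.
  have [_ Tl [C TC]] := bT; split=> [u _|c u v _ _|].
  - by rewrite TA /=; exact: proj_plusE.
  - exact: Tl.
  - by exists C => u _; exact: TC.
have [s Ts sle] := hsval_trace_norm (closed_Hplus (ip := ip) (J := J))
  (onb_Hplus (J := J)) bTp tT.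
have := @nneseries_lty _ (fun n => nrm (T (gbasis n)) ^+ 2) (fun n => sqr_ge0 _) hT.
set r := fine _ => Tr.
have Tps : hsval ip ebasis (T \o pp) s.
  apply: hsval_comp_proj Ts => //; first exact: closed_Hplus.
  - exact: onb_Hplus.
  - exact: adjoint_pair_proj_plus.
  - exact: proj_plusE.
  - exact: proj_plus_id.
have Tmr : hsval ip ebasis (T \o pm) r.
  apply: hsval_comp_proj Tr => //; first exact: closed_Hminus.
  - exact: onb_Hminus.
  - exact: adjoint_pair_proj_minus.
  - exact: proj_minusE.
  - exact: proj_minus_id.
have [t Tt tle] := hsval_add Tps Tmr.
have {}Tt : hsval ip ebasis T t.
  apply: hsval_ext Tt => n /=; rewrite -[X in _ = T X](proj_decomp J).
  by have [_ Tl _] := bT; rewrite -[T (pp _)]scale1r -Tl// scale1r.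
have [T' TT'] := adjoint_pair_ex bT.
(* [barop T] along a basis has the same norms as [T] along the conjugate basis. *)
have bTt : hsval ip ebasis (barop T) t.
  have h : hsval ip (fun n => hconj (ebasis n)) T t.
    exact: hsval_basis eB (hilbert_basis_hconj eB) TT' Tt.
  rewrite /hsval (_ : (fun n => _) =
    fun n => \sum_(0 <= k < n) nrm (T (hconj (ebasis k))) ^+ 2) //.
  by apply/funext => n; apply: eq_bigr => k _; rewrite /barop hnorm_hconj.
have [a Aa ale] := hsval_add Tt bTt.
have -> : gl12_norm ip J A = fine (trace_norm ip Hp T) + Num.sqrt r.
  by rewrite /r TA.
have r0 : 0 <= r by apply: hsval_ge0 Tr.
have tr0 : 0 <= fine (trace_norm ip Hp T).
  apply: fine_ge0; apply: nneseries_ge0 => n _ _; rewrite lee_fin.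
  have [_ P0 _] := absopP (closed_Hplus (ip := ip) (J := J)) (onb_Hplus (J := J)) bTp.
  have [fE _ _] : hilbert_basis ip Hp fbasis by exact: onb_Hplus.
  by have := P0 _ (fE n); rewrite lecE => /andP[].
split; first by rewrite addr_ge0 ?sqrtr_ge0.
exists a; first by apply: hsval_ext Aa => n; rewrite AT.
have := sqr_sqrtr r0; have := sqrtr_ge0 r; move: sle tr0 ale tle.
move: (fine _) (Num.sqrt r) => x y h1 h2 h3 h4 h5 h6; nra.
Qed.

End Gl12.
End RestrictedOperators.

(** * The momentum map property and the defect of equivariance *)

Section MomentumMap.
Context (R : realType) (V : completeNormedModType R) (ip : {dot V for idfun}).
Context {ip_norm : norm_of_dot ip}.
Context (J : {linear V -> V}) {J_ocs : orthogonal_complex_structure ip J}.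
Context {bases : polarized_bases ip J}.
Local Notation H := (complexification V).
Local Notation dot := (hdot ip).
Local Notation nrm := (hnorm ip).
Local Notation JC := (@JC R V J).
Local Notation Tr := (Tr ip).
Local Notation gl12 := (gl12 ip J).
Local Notation M12 := (M12 ip J).
Local Notation O12 := (O12 ip J).
Local Notation o12 := (o12 ip J).
Local Notation gnorm := (gl12_norm ip J).
Local Notation ebasis := (onb ip setT).
Local Notation bop := (bounded_op ip setT setT).
Implicit Types (u v w : H) (c : R[i]) (A B M S T W : H -> H).

Let eB : hilbert_basis ip setT ebasis.
Proof. exact: onb_setT. Qed.

Definition hilbert_schmidt T : Prop :=
  exists2 T', adjoint_pair ip T T' & exists s, hsval ip ebasis T s.
Local Notation hs := hilbert_schmidt.

Lemma hilbert_schmidt_adjoint T T' : adjoint_pair ip T T' -> hs T -> hs T'.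
Proof.
move=> TT' [_ _ [s Ts]]; exists T; first exact: adjoint_pairC.
by exists s; exact: hsval_adjoint eB eB TT' Ts.
Qed.

Lemma hilbert_schmidtD S T : hs S -> hs T -> hs (fun u => S u + T u).
Proof.
move=> [S' SS' [s Ss]] [T' TT' [t Tt]].
exists (fun u => S' u + T' u); first exact: adjoint_pairD.
by have [r STr _] := hsval_add Ss Tt; exists r.
Qed.

Lemma hilbert_schmidt_compl S T : bop S -> hs T -> hs (S \o T).
Proof.
move=> bS [T' TT' [t Tt]]; have [S' SS'] := adjoint_pair_ex bS.
exists (T' \o S'); first exact: adjoint_pair_comp.
have [C _ SC] := bounded_op_ge0 bS.
by have [r STr _] := hsval_comp (fun u => SC u Logic.I) Tt; exists r.
Qed.

(** Reduced to composition on the left by taking adjoints. *)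
Lemma hilbert_schmidt_compr S T : hs S -> bop T -> hs (S \o T).
Proof.
move=> hS bT; have [S' SS' _] := hS; have [T' TT'] := adjoint_pair_ex bT.
apply: (hilbert_schmidt_adjoint (adjoint_pair_comp (adjoint_pairC TT') (adjoint_pairC SS'))).
apply: hilbert_schmidt_compl; first by case: TT'.
exact: hilbert_schmidt_adjoint SS' hS.
Qed.

Lemma gl12_hilbert_schmidt A : gl12 A -> hs A.
Proof.
move=> gA; have [A' AA'] := adjoint_pair_ex (gl12_bounded gA).
by exists A' => //; have [_ [s As _]] := gl12_hsval gA; exists s.
Qed.

Lemma hilbert_schmidt_bounded T : hs T -> bop T.
Proof. by move=> [T' [bT _ _] _]. Qed.

Lemma Tr_hilbert_schmidt S T : hs S -> hs T ->
  trcvg ip ebasis (S \o T) (Tr (S \o T)) /\ Tr (S \o T) = Tr (T \o S).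
Proof.
move=> [S' SS' [s Ss]] [T' TT' [t Tt]].
have [z [STz TSz _]] := trcvg_comp eB eB SS' TT' Ss Tt.
by rewrite (Tr_trcvg STz) (Tr_trcvg TSz).
Qed.

Lemma Tr_hilbert_schmidt_cvg S T : hs S -> hs T ->
  trcvg ip ebasis (S \o T) (Tr (S \o T)).
Proof. by move=> hS hT; have [] := Tr_hilbert_schmidt hS hT. Qed.

Lemma Tr_hilbert_schmidtC S T : hs S -> hs T -> Tr (S \o T) = Tr (T \o S).
Proof. by move=> hS hT; have [] := Tr_hilbert_schmidt hS hT. Qed.

Lemma Tr_le S T s t : hs S -> hs T -> hsval ip ebasis S s ->
  hsval ip ebasis T t -> sqmod (Tr (S \o T)) <= s * t.
Proof.
move=> [S' SS' _] [T' TT' _] Ss Tt.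
have [z [STz _ zle]] := trcvg_comp eB eB SS' TT' Ss Tt.
by rewrite (Tr_trcvg STz).
Qed.

(** Conjugating the series gives the trace along the conjugate basis, which has the same value by
    independence of the basis. *)
Lemma Tr_barop S T : hs S -> hs T -> barop S = S -> barop T = T ->
  conjc (Tr (S \o T)) = Tr (S \o T).
Proof.
move=> [S' SS' [s Ss]] [T' TT' [t Tt]] bS bT.
have eB' := hilbert_basis_hconj eB.
have [z [STz TSz _]] := trcvg_comp eB eB SS' TT' Ss Tt.
have [w [TSw STw _]] := trcvg_comp eB eB' TT' SS' Tt Ss.
rewrite (Tr_trcvg STz) (ccvg_unique TSz TSw); apply: ccvg_unique STw.
rewrite -(ccvg_unique TSz TSw); move: (ccvgJ STz); congr (ccvg _ _).
apply/funext => n; rewrite conjc_sum; apply: eq_bigr => k _.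
rewrite -hdot_hconj; congr (hdot _ _).
by rewrite /= -{2}bS -{2}bT /barop !hconjK.
Qed.

Lemma trcvg_adjoint T T' z : adjoint_pair ip T T' -> trcvg ip ebasis T z ->
  trcvg ip ebasis T' (conjc z).
Proof.
move=> [_ _ TT'] /ccvgJ; congr (ccvg _ _); apply/funext => n.
by rewrite conjc_sum; apply: eq_bigr => k _; rewrite TT' -hdotC.
Qed.

Lemma o12_adjoint_pair A : o12 A -> adjoint_pair ip A (fun u => - A u).
Proof.
move=> [gA A0]; have [A' AA'] := adjoint_pair_ex (gl12_bounded gA).
suff <- : A' = fun u => - A u by [].
rewrite -(adjointE AA'); apply/funext => u.
by have := congr1 (fun f : H -> H => f u) A0 => /= /eqP; rewrite addr_eq0 => /eqP.
Qed.

Lemma barop_JC : barop JC = JC.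
Proof. by apply/funext => u; rewrite /barop hconj_JC hconjK. Qed.

Lemma barop_comp S T : barop (S \o T) = barop S \o barop T.
Proof. by apply/funext => u; rewrite /barop /= hconjK. Qed.

Lemma barop_adjoint T T' : adjoint_pair ip T T' -> barop T = T -> barop T' = T'.
Proof.
move=> TT' bT; apply: (adjoint_pair_unique _ TT').
by rewrite -bT; exact: adjoint_pair_barop.
Qed.

Definition defect M M' : H -> H := fun u => M' (JC (M u)) - JC u.

Lemma M12_adjoint M : M12 M -> exists M',
  [/\ adjoint_pair ip M M', barop M = M & hs (defect M M')].
Proof.
move=> gX; set X : H -> H := M - idfun in gX.
have hX := gl12_hilbert_schmidt gX; have [X' XX' _] := hX.
have ME : M = fun u => u + X u by apply/funext => u; rewrite /X /= addrC subrK.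
have MM' : adjoint_pair ip M (fun u => u + X' u).
  by rewrite {1}ME; exact: adjoint_pairD (adjoint_pair_id ip) XX'.
exists (fun u => u + X' u); split=> //.
  apply/funext => u; rewrite ME /barop hconjD hconjK; congr (_ + _).
  by rewrite -[X in _ = X u](gl12_barop gX).
have -> : defect M (fun u => u + X' u) =
    fun u => (X' \o JC) u + (((fun u => u + X' u) \o JC) \o X) u.
  apply/funext => u; rewrite /defect ME /= JC_D.
  have [_ [_ X'l _] _] := XX'.
  rewrite -[X in X' (X + _)]scale1r X'l// !scale1r.
  by rewrite addrAC [JC u + _]addrC addrK addrCA.
have [_ bM' _] := MM'.
apply: hilbert_schmidtD.
  apply: hilbert_schmidt_compr; last exact: bounded_op_JC.
  exact: hilbert_schmidt_adjoint XX' hX.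
apply: hilbert_schmidt_compl => //.
apply: bounded_op_comp => //; exact: bounded_op_JC.
Qed.

Lemma muOE M M' A : adjoint_pair ip M M' ->
  muO ip J M A = - 2^-1 * Tr (defect M M' \o A).
Proof. by move=> MM'; rewrite /muO (adjointE MM'). Qed.

Lemma defect_linear M M' c u v : adjoint_pair ip M M' ->
  defect M M' (c *: u + v) = c *: defect M M' u + defect M M' v.
Proof.
move=> [[_ Ml _] [_ M'l _] _]; rewrite /defect Ml// !JC_linear M'l//.
by rewrite opprD addrACA scalerBr.
Qed.

Lemma muO_dual M : M12 M -> o12_dual ip J (muO ip J M).
Proof.
move=> MM; have [M' [MM' bM hD]] := M12_adjoint MM.
have bD : barop (defect M M') = defect M M'.
  apply/funext => u; rewrite /barop /defect hconjD hconjN hconj_JC hconjK.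
  congr (_ - _); rewrite -[in RHS](barop_adjoint MM' bM) -[in RHS]barop_JC -[in RHS]bM.
  by rewrite /barop !hconjK.
split.
- move=> A [gA _]; rewrite (muOE A MM').
  have hA := gl12_hilbert_schmidt gA.
  generalize (Tr_barop hD hA bD (gl12_barop gA)).
  case: (Tr _) => a b /= [h]; have -> : b = 0 by lra.
  rewrite rpredM//; first by rewrite rpredN rpredV realn.
  by rewrite complex_real.
- move=> t A B [gA _] [gB _]; rewrite !(muOE _ MM').
  have hA := gl12_hilbert_schmidt gA; have hB := gl12_hilbert_schmidt gB.
  generalize (trcvgD (trcvgZ t%:C (Tr_hilbert_schmidt_cvg hD hA))
    (Tr_hilbert_schmidt_cvg hD hB)).
  rewrite (_ : (fun u => _) = defect M M' \o (t%:C *: A + B)); last first.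
    by apply/funext => u; rewrite /= -(defect_linear _ _ _ MM').
  by move=> /Tr_trcvg ->; ring.
- have [_ _ [d Dd]] := hD; have d0 := hsval_ge0 Dd.
  (* Cauchy-Schwarz bounds the squared trace by [d a], where [a] is at most 8 times the squared norm
     of gl12; the factor -1/2 of [muO] only improves this. *)
  exists (Num.sqrt (8 * d)) => A [gA _]; rewrite (muOE A MM').
  have hA := gl12_hilbert_schmidt gA; have [N0 [a Aa ale]] := gl12_hsval gA.
  generalize (Tr_le hD hA Dd Aa); set z := Tr _ => zle.
  rewrite normc_sqmod lecR -[X in _ <= _ * X](ger0_norm N0) -sqrtr_sqr.
  rewrite -sqrtrM ?mulr_ge0// ler_wsqrtr// sqmodM.
  have -> : sqmod (- 2^-1 : R[i]) = 4^-1.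
    have -> : (- 2^-1 : R[i]) = (- 2^-1 : R)%:C by rewrite rmorphN fmorphV rmorph_nat.
    by rewrite sqmod_real; field.
  have := sqmod_ge0 z; nra.
Qed.

(** With [z = Tr (M^* J W A)] and [q = Tr (W^* J W A)], the trace in [muO] grows by [2 z + q], as
    both cross terms equal [z]. Since [omegaM (M A) W = - z], the error is [- q / 2], quadratic in
    [W]. *)
Lemma muO_differential M A : M12 M -> o12 A -> forall eps : R, 0 < eps ->
  exists2 delta : R, 0 < delta & forall W, gl12 W -> gnorm W < delta ->
    `|muO ip J (M + W) A - muO ip J M A - omegaM ip J (M \o A) W|
      <= (eps * gnorm W)%:C.
Proof.
move=> MM oA eps eps0.
have [M' [MM' bM hD]] := M12_adjoint MM.
have [gA _] := oA; have hA := gl12_hilbert_schmidt gA.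
have AA' := o12_adjoint_pair oA.
have [C C0 AC] := bounded_op_ge0 (gl12_bounded gA).
(* [4 C] is half of the constant in the bound [8 C N^2] on [q], with [N] the norm of [W]; the
   summand 1 covers [C = 0]. *)
have d0 : 0 < 4 * C + 1 by rewrite ltr_wpDl ?mulr_ge0.
exists (eps / (4 * C + 1)); first exact: divr_gt0.
move=> W gW Wlt.
have hW := gl12_hilbert_schmidt gW; have [W' WW' _] := hW.
have hW' := hilbert_schmidt_adjoint WW' hW.
have [[bdM Ml _] [bdM' M'l _] _] := MM'; have [[bdW Wl _] [bdW' W'l _] _] := WW'.
have [bM0 bM'0 _] := MM'.
have bJ : bop JC by exact: bounded_op_JC.
have MW : adjoint_pair ip (M + W) (fun u => M' u + W' u).
  exact: adjoint_pairD MM' WW'.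
have hMJW : hs (M' \o JC \o W).
  by apply: hilbert_schmidt_compl => //; exact: bounded_op_comp.
have hWJM : hs (W' \o (JC \o M)).
  by apply: hilbert_schmidt_compr => //; exact: bounded_op_comp.
have hJWA : hs (JC \o W \o A).
  apply: hilbert_schmidt_compl => //; apply: bounded_op_comp => //.
  exact: hilbert_schmidt_bounded.
set z := Tr (M' \o JC \o W \o A); set q := Tr (W' \o (JC \o W \o A)).
have zA : Tr (A \o (M' \o JC \o W)) = z by rewrite /z Tr_hilbert_schmidtC.
have z_real : conjc z = z.
  apply: Tr_barop => //; last exact: gl12_barop.
  rewrite (barop_comp (M' \o JC) W) (barop_comp M' JC).
  by rewrite (barop_adjoint MM' bM) barop_JC (gl12_barop gW).
(* [W^* J M A] is the adjoint of [A M^* J W], the signs of [A^* = - A] and [J^* = - J] cancelling;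
   and [z] is real. *)
have WJM : trcvg ip ebasis ((W' \o (JC \o M)) \o A) z.
  rewrite -z_real -zA.
  generalize (Tr_hilbert_schmidt_cvg hA hMJW); apply: trcvg_adjoint.
  generalize (adjoint_pair_comp AA' (adjoint_pair_comp (adjoint_pair_comp
    (adjoint_pairC MM') (adjoint_pair_JC (ip := ip) (J := J))) WW')).
  congr (adjoint_pair _ _ _); apply/funext => u /=.
  have MN w : M (- w) = - M w.
    have := Ml (-1) w 0 Logic.I Logic.I.
    by rewrite addr0 (linear_on0 (E := setT) Logic.I Ml) addr0 !scaleN1r.
  have JN w : JC (- w) = - JC w by rewrite -[- w]scaleN1r JC_Z scaleN1r.
  by rewrite MN JN opprK.
have Tr_MW : Tr (defect (M + W) (fun u => M' u + W' u) \o A) =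
    Tr (defect M M' \o A) + z + (z + q).
  apply: Tr_trcvg.
  generalize (trcvgD (trcvgD (Tr_hilbert_schmidt_cvg hD hA) (Tr_hilbert_schmidt_cvg hMJW hA))
    (trcvgD WJM (Tr_hilbert_schmidt_cvg hW' hJWA))).
  congr (trcvg _ _ _ _); apply/funext => u.
  rewrite /defect /= JC_D -[JC (M _)]scale1r M'l// W'l// !scale1r.
  by rewrite [RHS]addrAC [X in _ = X + _]addrAC.
have omegaE : omegaM ip J (M \o A) W = - z.
  rewrite /omegaM (adjointE (adjoint_pair_comp MM' AA')) -zA.
  apply: Tr_trcvg; generalize (trcvgZ (-1) (Tr_hilbert_schmidt_cvg hA hMJW)).
  rewrite mulN1r; congr (trcvg _ _ _ _); apply/funext => u /=.
  by rewrite scaleN1r.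
rewrite (muOE A MW) (muOE A MM') Tr_MW omegaE.
have -> : - 2^-1 * (Tr (defect M M' \o A) + z + (z + q)) -
    - 2^-1 * Tr (defect M M' \o A) - - z = - 2^-1 * q by field.
have [N0 [w Ww wle]] := gl12_hsval gW; have w0 := hsval_ge0 Ww.
have W'w : hsval ip ebasis W' w by exact: hsval_adjoint eB eB WW' Ww.
(* [hsval_comp] bounds a factor on the left, so the estimate is made on [- A W^*], the adjoint of
   [W A]; composing with [J] preserves norms. *)
have [r JWAr rle] : exists2 r, hsval ip ebasis (JC \o W \o A) r & r <= C ^+ 2 * w.
  have AC' u : nrm (- A u) <= C * nrm u by rewrite hnormN AC.
  have [r Ar rle] := hsval_comp AC' W'w; exists r => //.
  have : hsval ip ebasis (W \o A) r.
    apply: hsval_adjoint eB eB _ Ar.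
    exact: adjoint_pairC (adjoint_pair_comp WW' AA').
  by rewrite /hsval; under eq_fun do under eq_bigr do
    rewrite /= -(hnorm_JC (ip := ip) (J := J)).
pose proof (Tr_le hW' hJWA W'w JWAr) as qle.
have {}qle : sqmod q <= (8 * C * gnorm W ^+ 2) ^+ 2.
  apply: le_trans qle _.
  apply: (@le_trans _ _ (C ^+ 2 * w ^+ 2)).
    by rewrite mulrC expr2 mulrA ler_wpM2r.
  rewrite -exprMn ler_pXn2r ?nnegrE ?mulr_ge0 ?exprn_ge0//.
  by rewrite [8 * C]mulrC -mulrA ler_wpM2l.
rewrite normc_sqmod lecR sqmodM.
have -> : sqmod (- 2^-1 : R[i]) = (2^-1) ^+ 2.
  have -> : (- 2^-1 : R[i]) = (- 2^-1 : R)%:C by rewrite rmorphN fmorphV rmorph_nat.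
  by rewrite sqmod_real sqrrN.
rewrite sqrtrM ?sqr_ge0// sqrtr_sqr ger0_norm//.
have sq : Num.sqrt (sqmod q) <= 8 * C * gnorm W ^+ 2.
  rewrite -[leRHS]ger0_norm ?mulr_ge0 ?exprn_ge0// -sqrtr_sqr.
  exact: ler_wsqrtr.
move: Wlt; rewrite ltr_pdivlMr// => Wlt.
move: (gnorm W) N0 Wlt sq {wle qle} => x x0 xlt sq; nra.
Qed.

Lemma muO_momentum_map : momentum_map ip J (muO ip J).
Proof. by split=> [M|M A]; [exact: muO_dual|exact: muO_differential]. Qed.

(** A left inverse agrees with a two-sided one, so the single map [b] stands for both the adjoint
    and the inverse of [a]. *)
Lemma O12_inverse a : O12 a -> M12 a /\ exists b,
  [/\ adjoint_pair ip a b, inverse_op a = b & forall u, b (a u) = u /\ a (b u) = u].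
Proof.
move=> [[Ma [b [_ ab ba]]] aa]; split=> //; exists b.
have [a' [aa' _ _]] := M12_adjoint Ma; rewrite (adjointE aa') in aa.
have a'b : a' = b.
  apply/funext => u; have := congr1 (fun f : H -> H => f u) ab => /= {1}<-.
  exact: (congr1 (fun f : H -> H => f (b u)) aa).
split; first by rewrite -a'b.
- apply: xget_unique => // b' [ab' b'a]; apply/funext => u.
  have := congr1 (fun f : H -> H => f u) ab => /= {1}<-.
  exact: (congr1 (fun f : H -> H => f (b u)) b'a).
- move=> u; split; first exact: (congr1 (fun f : H -> H => f u) ba).
  exact: (congr1 (fun f : H -> H => f u) ab).
Qed.

Lemma muO_defect_equivariance M a A : M12 M -> O12 a -> o12 A ->
  muO ip J (M \o a) A - coAd a (muO ip J M) A =
  - 2^-1 * Tr ((inverse_op a \o JC \o a - JC) \o A).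
Proof.
move=> MM Oa [gA _]; have [M' [MM' bM hD]] := M12_adjoint MM.
have [Ma [b [ab abE abK]]] := O12_inverse Oa.
have [a' [aa' _ hDa]] := M12_adjoint Ma.
rewrite (adjoint_pair_unique aa' ab) in hDa => {a' aa'}.
have hA := gl12_hilbert_schmidt gA; have [ba bb _] := ab.
rewrite /coAd abE (muOE _ (adjoint_pair_comp MM' ab)) (muOE _ MM').
have haA : hs (a \o A) by exact: hilbert_schmidt_compl.
have hbD : hs (b \o defect M M') by exact: hilbert_schmidt_compl.
have haAb : hs (a \o A \o b) by exact: hilbert_schmidt_compr.
rewrite (Tr_hilbert_schmidtC hD haAb).
have -> : Tr (defect (M \o a) (b \o M') \o A) =
    Tr (a \o A \o b \o defect M M') + Tr (defect a b \o A).
  apply: Tr_trcvg.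
  (* With [D = M^* J M - J], grouping the factors as [(b D) (a A)], both Hilbert-Schmidt, cyclicity
     reaches the trace of [a A b D] already obtained from the coadjoint term. *)
  rewrite -[Tr (a \o A \o b \o _)](Tr_hilbert_schmidtC hbD haA).
  generalize (trcvgD (Tr_hilbert_schmidt_cvg hbD haA) (Tr_hilbert_schmidt_cvg hDa hA)).
  congr (trcvg _ _ _ _); apply/funext => u; rewrite /defect /=.
  have [_ [_ bl _] _] := ab.
  by rewrite [M' _ - _]addrC -[- JC (a _)]scaleN1r bl// scaleN1r [- _ + _]addrC addrA subrK.
by rewrite mulrDr addrAC subrr add0r.
Qed.

End MomentumMap.

(** * A reflection that violates equivariance *)

Section Counterexample.
Context (R : realType) (V : completeNormedModType R) (ip : {dot V for idfun}).
Context {ip_norm : norm_of_dot ip}.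
Context (J : {linear V -> V}) {J_ocs : orthogonal_complex_structure ip J}.
Context {bases : polarized_bases ip J}.
Local Notation H := (complexification V).
Local Notation dot := (hdot ip).
Local Notation nrm := (hnorm ip).
Local Notation JC := (@JC R V J).
Local Notation Hp := (@Hplus R V J).
Local Notation Hm := (@Hminus R V J).
Local Notation ebasis := (onb ip setT).
Local Notation fbasis := (onb ip Hp).
Local Notation gbasis := (onb ip Hm).
Implicit Types (u v w : H) (c d : R[i]).

Lemma trcvg_rank1 (p q : H) : trcvg ip ebasis (fun u => dot u p *: q) (dot q p).
Proof.
have eB : hilbert_basis ip setT ebasis by exact: onb_setT.
generalize (parseval_hdot (closed_subspaceT ip) eB p (u := q) Logic.I).
rewrite /trcvg; congr (ccvg _ _); apply/funext => n; apply: eq_bigr => k _.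
by rewrite hdotZl mulrC.
Qed.

Local Notation x := (fbasis 0%N).
Local Notation y := (hconj (fbasis 0%N)).

Let fB : hilbert_basis ip Hp fbasis. Proof. exact: onb_Hplus. Qed.
Let gB : hilbert_basis ip Hm gbasis. Proof. exact: onb_Hminus. Qed.
Let xP : Hp x. Proof. by case: fB. Qed.
Let yM : Hm y. Proof. exact: hconj_plus. Qed.
Let xx : dot x x = 1. Proof. by case: fB => _ ->. Qed.
Let yy : dot y y = 1. Proof. by rewrite hdot_hconj xx conjc1. Qed.
Let xy : dot x y = 0. Proof. exact: (hdot_plus_minus xP yM). Qed.
Let yx : dot y x = 0. Proof. by rewrite hdotC xy conjc0. Qed.
Let nx : nrm x = 1.
Proof. by rewrite /hnorm xx /= sqrtr1. Qed.
Let ny : nrm y = 1.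
Proof. by rewrite hnorm_hconj nx. Qed.

Let bounded_rank1 (E : set H) (p : H) c : nrm p <= 1 ->
  bounded_op ip E Hp (fun u => (dot u p * c) *: x).
Proof.
move=> p1; split.
- by move=> u _; apply: (subspaceZ _ (closed_Hplus (ip := ip) (J := J))).
- by move=> k u v _ _; rewrite hdotDl hdotZl mulrDl scalerDl -mulrA scalerA.
- exists (Num.sqrt (sqmod c)) => u _; rewrite hnormZ nx mulr1 sqmodM.
  rewrite sqrtrM ?sqmod_ge0// mulrC ler_wpM2l ?sqrtr_ge0//.
  by apply: le_trans (hdot_le _ _) _; rewrite ler_piMr ?hnorm_ge0.
Qed.

(** Taking [x] as the first vector of the chosen basis reduces the trace norm to one term: [T] kills
    every later basis vector [f], hence so does [P = |T|], because [|P f| = |T f|]. *)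
Lemma L1_rank1 c : L1 ip Hp Hp (fun u => (dot u x * c) *: x).
Proof.
have bT : bounded_op ip Hp Hp (fun u => (dot u x * c) *: x).
  by apply: bounded_rank1; rewrite nx.
split=> //; set T := fun u => _ in bT *.
have cE : closed_subspace ip Hp by exact: closed_Hplus.
have [[PE Pl _] P0 PP] := absopP cE fB bT.
rewrite /trace_norm; set P := absop ip Hp T in PE Pl P0 PP *.
have fE n : Hp (fbasis n) by case: fB.
pose q n := complex.Re (dot (P (fbasis n)) (fbasis n)).
have q0 n : 0 <= q n by have := P0 _ (fE n); rewrite lecE => /andP[].
have qS n : q n.+1 = 0.
  suff Pf0 : P (fbasis n.+1) = 0 by rewrite /q Pf0 hdot0l.
  apply: (@hnorm0_eq0 _ _ ip); apply/eqP; rewrite -sqrf_eq0 hnormE.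
  have Tf0 : T (fbasis n.+1) = 0.
    by have [_ f_on _] := fB; rewrite /T f_on /= mul0r scale0r.
  have := PP _ _ (fE n.+1) (fE n.+1).
  rewrite (positive_hermitian cE Pl P0 (fE n.+1) (PE _ (fE n.+1))) Tf0 hdot0l.
  by move=> /(congr1 (@conjc R)); rewrite conjcK conjc0 => ->.
have [|s qs _] := @ge0_series_cvg R q (q 0%N) q0.
  case=> [|n]; first by rewrite big_geq.
  by rewrite big_nat_recl// big1 ?addr0.
by rewrite (nneseries_EFin qs) ltry.
Qed.

(** The chosen basis of [H-] is unrelated to [y], so the sum is bounded by Bessel's inequality. *)
Lemma L2_rank1 d : L2 ip Hm Hp (fun u => (dot u y * d) *: x).
Proof.
split; first by apply: bounded_rank1; rewrite ny.
have [_ g_on _] := gB.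
have [|s hs _] := @hsval_ex _ _ ip gbasis (fun u => (dot u y * d) *: x) (sqmod d).
  move=> n; apply: (@le_trans _ _ (\sum_(0 <= k < n) sqmod (dot y (gbasis k)) * sqmod d)).
    apply: ler_sum => k _; rewrite hnormZ2 nx expr1n mulr1 sqmodM.
    by rewrite (hdotC ip (gbasis k)) sqmod_conj.
  rewrite -mulr_suml ler_piMl ?sqmod_ge0//.
  by apply: le_trans (bessel g_on _ _) _; rewrite ny expr1n.
by rewrite /hs_sqnorm (nneseries_EFin hs) ltry.
Qed.

(** Zero on the orthogonal complement of the plane of [x] and [y]; on it, the matrix with rows
    [(c, d)] and [(conj d, conj c)], the block shape of gl12 with blocks of size one. *)
Definition rank2_op c d (w : H) : H :=
  dot w x *: (c *: x + conjc d *: y) + dot w y *: (d *: x + conjc c *: y).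

Lemma gl12_rank2_op c d : gl12 ip J (rank2_op c d).
Proof.
exists (fun u => (dot u x * c) *: x), (fun u => (dot u y * d) *: x).
split; [exact: L1_rank1|exact: L2_rank1|].
move=> u v Hu Hv; rewrite /rank2_op !hdotDl.
rewrite (hdot_plus_minus Hu yM) add0r [dot v x]hdotC (hdot_plus_minus xP Hv).
rewrite conjc0 addr0 /barop !hconjZ !conjcM.
have -> : dot (hconj u) y = conjc (dot u x) by rewrite hdot_hconj.
have -> : dot (hconj v) x = conjc (dot v y).
  by rewrite -(hconjK x) hdot_hconj hconjK.
by rewrite !conjcK !scalerDr !scalerA addrACA.
Qed.

Local Notation s := (x + y).
Definition reflection (w : H) : H := w + rank2_op (-1) (-1) w.
Local Notation a := reflection.
Local Notation A := (rank2_op 'i%C 0).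

Let aE w : a w = w - dot w s *: s.
Proof.
rewrite /reflection /rank2_op; have -> : conjc (-1) = -1 :> R[i] by rewrite conjcN conjc1.
by rewrite -!scalerDr -scalerDl -hdotDr scaleN1r scalerN.
Qed.

Let ss : dot s s = 2.
Proof. by rewrite hdotDl !hdotDr xx xy yx yy addr0 add0r. Qed.

Let aa w : a (a w) = w.
Proof.
rewrite (aE (a w)) (aE w) hdotBl hdotZl ss scalerBl mulr_natr mulr2n scalerDl.
by rewrite opprB addrK subrK.
Qed.

Let AE w : A w = ('i%C * dot w x) *: x + (- ('i%C * dot w y)) *: y.
Proof.
rewrite /rank2_op conjc0 !scale0r addr0 add0r !scalerA; congr (_ *: _ + _ *: _).
  by rewrite mulrC.
rewrite (_ : conjc 'i%C = - 'i%C) ?mulrN 1?mulrC//.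
by apply: complex_ext => //=; rewrite oppr0.
Qed.

Let M12a : M12 ip J a.
Proof.
rewrite /M12 (_ : _ - _ = rank2_op (-1) (-1)); first exact: gl12_rank2_op.
by apply/funext => w; rewrite -[LHS]/(a w - w) /reflection addrC addKr.
Qed.

Let adj_a : adjoint_pair ip a a.
Proof.
have ba : bounded_op ip setT setT a.
  rewrite /reflection; apply: bounded_opD; first exact: bounded_op_id.
  exact: gl12_bounded (gl12_rank2_op _ _).
split=> // u v; rewrite !aE hdotBl hdotBr hdotZl hdotZr -hdotC.
by rewrite mulrC.
Qed.

Let O12a : O12 ip J a.
Proof.
split; last by rewrite (adjointE adj_a); apply/funext => w; exact: aa.
by split=> //; exists a; split=> //; apply/funext => w; exact: aa.
Qed.

Let o12A : o12 ip J A.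
Proof.
have bA : bounded_op ip setT setT A by exact: gl12_bounded (gl12_rank2_op _ _).
split; first exact: gl12_rank2_op.
have AA' : adjoint_pair ip A (fun u => -1 *: A u).
  split=> //; first exact: bounded_opZ.
  move=> u v; rewrite hdotZr !AE hdotDl hdotDr !hdotZl !hdotZr.
  rewrite !conjcN !conjcM -!hdotC conjc1.
  rewrite (_ : conjc 'i%C = - 'i%C); last by apply: complex_ext => //=; rewrite oppr0.
  by ring.
rewrite (adjointE AA'); apply/funext => u.
by rewrite -[LHS]/(-1 *: A u + A u) scaleN1r addNr.
Qed.

(** The reflection sends [x] to [- y] and [y] to [- x]. It exchanges eigenvectors of [J] with
    opposite eigenvalues, so conjugation by it reverses the sign of [J] on the plane. *)
Let a_xy c d : a (c *: x + d *: y) = (- d) *: x + (- c) *: y.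
Proof.
rewrite aE hdotDl !hdotZl !hdotDr xx xy yx yy addr0 add0r !mulr1.
rewrite -scaleNr scalerDr addrACA -!scalerDl.
by congr (_ *: _ + _ *: _); ring.
Qed.

Let JC_xy c d : JC (c *: x + d *: y) = ('i%C * c) *: x + (- ('i%C * d)) *: y.
Proof.
rewrite JC_linear JC_Z; move: xP yM; rewrite /Hplus /Hminus /= => -> ->.
by rewrite !scalerA mulrN mulrC [d * _]mulrC.
Qed.

Lemma Tr_counterexample : Tr ip ((inverse_op a \o JC \o a - JC) \o A) = 4.
Proof.
have [_ [b [_ -> baK]]] := O12_inverse O12a.
have ba w : b w = a w by rewrite -{1}(aa w) (baK _).1.
apply: Tr_trcvg.
(* On the plane [A] coincides with [J], so [- 2 A A] is twice the projection onto it, the sum of two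
   rank-one projections of trace 1. *)
generalize (trcvgD (trcvgZ 2 (trcvg_rank1 x x)) (trcvgZ 2 (trcvg_rank1 y y))).
rewrite xx yy (_ : 2 * 1 + 2 * 1 = 4 :> R[i]); last by ring.
congr (trcvg _ _ _ _); apply/funext => w.
rewrite -[RHS]/(b (JC (a (A w))) - JC (A w)) ba AE a_xy !JC_xy a_xy.
have ii k : 'i%C * ('i%C * k) = - k :> R[i].
  by rewrite mulrA (_ : 'i%C * 'i%C = -1 :> R[i]) ?mulN1r//; simpc.
rewrite !(mulrN, opprK, ii) !scalerA opprD -!scaleNr addrACA -!scalerDl !opprK.
by congr (_ *: _ + _ *: _); ring.
Qed.

Lemma muO_not_equivariant : ~ equivariant ip J (muO ip J).
Proof.
(* The defect does not depend on the point [M], so the identity is taken; there the defect is -2. *)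
have M12_id : M12 ip J idfun.
  rewrite /M12 (_ : _ - _ = rank2_op 0 0); first exact: gl12_rank2_op.
  apply/funext => w; rewrite -[LHS]/(w - w) subrr /rank2_op.
  by rewrite conjc0 !scale0r !addr0 !scaler0 addr0.
move=> eqv; generalize (muO_defect_equivariance M12_id O12a o12A).
rewrite (eqv _ _ M12_id O12a _ o12A) subrr Tr_counterexample => /esym/eqP.
by rewrite mulf_eq0 oppr_eq0 invr_eq0 !pnatr_eq0.
Qed.

End Counterexample.

Theorem theorem3 (R : realType) (V : completeNormedModType R)
    (ip : {dot V for idfun}) (J : {linear V -> V})
    (ip_norm : forall v : V, `|v| ^+ 2 = ip v v)
    (V_infinite_dim : ~ exists (n : nat) (e : 'I_n -> V),
       forall v : V, exists c : 'I_n -> R, v = \sum_(i < n) c i *: e i)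
    (V_separable : exists2 D : set V, countable D & dense D)
    (J_bounded : exists C : R, forall v : V, `|J v| <= C * `|v|)
    (J_square : forall v : V, J (J v) = - v)
    (J_isometry : forall u v : V, ip (J u) (J v) = ip u v) :
  [/\ momentum_map ip J (muO ip J),
      ~ equivariant ip J (muO ip J)
    & forall M a A : complexification V -> complexification V,
        M12 ip J M -> O12 ip J a -> o12 ip J A ->
        muO ip J (M \o a) A - coAd a (muO ip J M) A =
        - 2^-1 * Tr ip ((inverse_op a \o JC J \o a - JC J) \o A)].
Proof.
have n_dot : norm_of_dot ip by [].
have J_ocs : orthogonal_complex_structure ip J by split.
(* Infinite dimension and separability enter here: they make the value of [xget] in [onb] an actual
   basis. *)
have basis E : closed_subspace ip E -> (forall v : V, exists2 u, E u & u.1 = v) ->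
    hilbert_basis ip E (onb ip E).
  move=> cE E1; apply: xgetPex.
  exact: hilbert_basis_exists cE V_infinite_dim V_separable E1.
have bases : polarized_bases ip J.
  split; apply: basis.
  - exact: closed_subspaceT.
  - by move=> v; exists (v, 0).
  - exact: closed_Hplus.
  - exact: Hplus_fst.
  - exact: closed_Hminus.
  - exact: Hminus_fst.
split; first exact: muO_momentum_map.
  exact: muO_not_equivariant.
by move=> M a A; exact: muO_defect_equivariance.
Qed.
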